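(* Let $B$ be a standard Brownian motion, $\mu\in\mathbb{R}$, and $A^{(\mu)}_t=\int_0^te^{2(B_u+\mu u)}\,du$. Fix $\beta>0$ and $t>0$. For $x\ge0$ define $$G_t(x)=e^{-t\mu^2/2}\,\mathbb{E}\exp\Big(\mu B_t+\frac{1}{2t}\big(B_t^2-\varphi_x^2(B_t)\big)\Big),\quad \varphi_x(y)=\ln\Big(xe^{-y}+\cosh(y)+\sqrt{x^2e^{-2y}+\sinh^2(y)+2xe^{-y}\cosh(y)}\Big).$$ Then $$\mathbb{E}\ln\big(1+\beta A^{(\mu)}_t\big)=\int_0^\infty\frac{G_t(y)}{y}\big(1-e^{-y\beta}\big)\,dy,\qquad \mathbb{E}\Big(\frac{1}{1+\beta A^{(\mu)}_t}\Big)=1-\beta\int_0^\infty G_t(y)e^{-y\beta}\,dy.$$ *)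

(* Defs.v *)
From HB Require Import structures.
From mathcomp Require Import all_boot all_order all_algebra.
From mathcomp Require Import all_classical all_reals all_analysis.
Set Implicit Arguments. Unset Strict Implicit. Unset Printing Implicit Defensive.
Import Order.TTheory GRing.Theory Num.Theory.
Import numFieldNormedType.Exports.
Local Open Scope classical_set_scope.
Local Open Scope ring_scope.

Definition cosh {R : realType} (y : R) : R := (expR y + expR (- y)) / 2.
Definition sinh {R : realType} (y : R) : R := (expR y - expR (- y)) / 2.

(* Standard (one-dimensional) Brownian motion B = (B_t)_{t >= 0} on the
   probability space (T, P): B_0 = 0, every path t |-> B_t(w) is continuous on
   [0, +oo), every B_t is measurable, and for all times
   0 = t_0 < t_1 < ... < t_n the increments B_{t_(i+1)} - B_{t_i} (i < n) are
   independent with law N(0, t_(i+1) - t_i), i.e. for all Borel sets A_i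
     P (\bigcap_i {B_{t_(i+1)} - B_{t_i} \in A_i}) = \prod_i N(0, t_(i+1)-t_i)(A_i).
   (normal_prob m s is the normal law with mean m and standard deviation s.)
   Values of B at negative times are irrelevant. *)
Definition is_standard_BM {R : realType} {d : measure_display}
    {T : measurableType d} (P : probability T R) (B : R -> T -> R) : Prop :=
  [/\ (forall w, B 0 w = 0),
      (forall w, {within `[0%R, +oo[, continuous (fun t => B t w)}),
      (forall t, 0 <= t -> measurable_fun setT (B t)) &
      (forall (n : nat) (tt : nat -> R) (A : nat -> set R),
         tt 0%N = 0 ->
         (forall i, (i < n)%N -> tt i < tt i.+1) ->
         (forall i, (i < n)%N -> measurable (A i)) ->
         P (\bigcap_(i in `I_n) [set w | A i (B (tt i.+1) w - B (tt i) w)])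
         = (\prod_(i < n) normal_prob 0 (Num.sqrt (tt i.+1 - tt i)) (A i))%E)].

Definition expBM_functional {R : realType} {T : Type} (B : R -> T -> R)
    (mu t : R) (w : T) : R :=
  Rintegral lebesgue_measure `[0, t] (fun u => expR (2 * (B u w + mu * u))).

Definition phi {R : realType} (x y : R) : R :=
  ln (x * expR (- y) + cosh y +
      Num.sqrt (x ^+ 2 * expR (- (2 * y)) + sinh y ^+ 2
                + 2 * x * expR (- y) * cosh y)).

Definition G {R : realType} {d : measure_display} {T : measurableType d}
    (P : probability T R) (B : R -> T -> R) (mu t x : R) : \bar R :=
  ((expR (- (t * mu ^+ 2) / 2))%:E *
   \int[P]_w (expR (mu * B t w
                    + (B t w ^+ 2 - phi x (B t w) ^+ 2) / (2 * t)))%:E)%E.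

(* Main.v *)
(* Write Y = B_t + mu t, A = A_t^(mu) and r = e^Y / A.  Everything reduces to
   the Laplace transform E exp(-x / A) = G_t(x) for x > 0: with it, Tonelli and
   the integrals of exp(-c y) and exp(-c y) (1 - exp(-beta y)) / y over the
   half-line give both formulas.

   For the Laplace transform, discretise [0, t].  Under the Gaussian weight
   e^(2 xi) of one increment xi, that increment is shifted; summing over the
   increments and refining the grid yields, for C^1 test functions Phi,
     E[(e^(2Y) - 1) Phi(Y, A)]
       = E[2 (1 + mu) A Phi + 2 A Phi_y + 2 A^2 Phi_a].
   With K(y) = cosh y + x e^(-y) and
     Phi_s = A^-1 exp(r (cosh Y - K(Y + s)) - mu Y) q(Y + s)
   (times a cutoff in r) it says that E[A Phi_s] does not depend on s.  Taking
   q(y) = f(y) p(y - h) e^(mu y) for a bump p and integrating over h gives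
     (int p) E[e^(-x / A) f(Y)] = int f(z) e^(mu z) kappa(cosh z + x e^(-z)) dz
   with kappa(C) = E[exp(r (cosh Y - C) - mu Y) p(Y)].  For x = 0 the left-hand
   side is a Gaussian integral, which determines the nonincreasing function
   kappa on ]1, +oo[; the case f = 1 then gives G_t(x), because
   cosh (phi_x z) = cosh z + x e^(-z). *)

Require Import Defs.
From HB Require Import structures.
From mathcomp Require Import all_boot all_order all_algebra.
From mathcomp Require Import all_classical all_reals all_analysis.
From mathcomp Require Import measurable_realfun ring lra.
Import Order.TTheory GRing.Theory Num.Theory.
Import numFieldNormedType.Exports.
Local Open Scope classical_set_scope.
Local Open Scope ring_scope.

Set Implicit Arguments.
Unset Strict Implicit.
Unset Printing Implicit Defensive.

(** * Gaussian integrals *)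

Section measure_lemmas.
Local Open Scope ereal_scope.

(** The integration by parts involves only the derivation D = d/dy + a d/da, and D annihilates r =
    e^y / a. Functions of r therefore pass through it as constants: the cutoff in r, which makes the
    test functions bounded and lets them vanish for large a, leaves no trace in the result. With
    Theta = a Phi the identity reads E[D Theta + (mu - r sinh Y) Theta] = 0, that is
    E[exp(r cosh Y - mu Y) (d/dy psi)(r, Y)] = 0 for Theta = exp(r cosh y - mu y) psi(r, y). In
    other words, given r, the law of Y has density proportional to exp(mu y - r cosh y), and the
    weight exp(r cosh Y - mu Y) turns it into Lebesgue measure; hence the invariance under
    translations. Since x / A = x r e^(-Y), the factor e^(-x / A) merely replaces cosh by K, so the
    problems for x and for 0 share the kernel kappa. Neither finiteness nor continuity of kappa is
    known beforehand: hence integrals of nonnegative functions in the extended reals, and a squeeze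
    that asks only monotonicity of kappa. *)

Lemma lebesgue_measure_shift (R : realType) (h : R) (A : set R) :
  measurable A ->
  pushforward (@lebesgue_measure R)
    ((fun x => x + h)%R : _ -> measurableTypeR R) A = lebesgue_measure A.
Proof.
move=> mA.
have mh : measurable_fun [set: measurableTypeR R]
    ((fun x => x + h)%R : _ -> measurableTypeR R) by exact: measurable_funD.
have mE X : ocitv X -> lebesgue_measure X = pushforward (@lebesgue_measure R)
    ((fun x => x + h)%R : _ -> measurableTypeR R) X; last first.
  pose m := (pushforward (@lebesgue_measure R)
      ((fun x => x + h)%R : _ -> measurableTypeR R) : {measure set (measurableTypeR R) -> \bar R}).
  by apply/esym; exact: (@lebesgue_measure_unique R (m mh) mE A mA).
move: X => _ [[a b]] _ <- /=.
rewrite /pushforward/= (_ : (fun x => x + h)%R @^-1` _ = `](a - h)%R, (b - h)%R]%classic).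
  by rewrite !lebesgue_measure_itv/= !lte_fin ltrD2r -!EFinB opprB addrA subrK.
by apply/seteqP; split => x /=; rewrite !in_itv/= ltrBlDr lerBrDr.
Qed.

Lemma ge0_integral_shift (R : realType) (h : R) (f : R -> \bar R) :
  measurable_fun setT f -> (forall x, 0 <= f x) ->
  \int[lebesgue_measure]_x f (x + h)%R = \int[lebesgue_measure]_x f x.
Proof.
move=> mf f0.
have mh : measurable_fun [set: measurableTypeR R]
    ((fun x => x + h)%R : _ -> measurableTypeR R) by exact: measurable_funD.
have := @ge0_integral_pushforward _ _ _ _ R _ mh (@lebesgue_measure R) setT f.
rewrite preimage_setT => <- //.
by apply: eq_measure_integral => A mA _; exact: (lebesgue_measure_shift h mA).
Qed.

Import HBNNSimple.

Lemma ge0_integral_density d (T : measurableType d) (R : realType)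
    (mu nu : {measure set T -> \bar R}) (g : T -> R) (f : T -> \bar R) :
  measurable_fun setT g -> (forall x, 0 <= g x)%R ->
  (forall A, measurable A -> nu A = \int[mu]_(x in A) (g x)%:E) ->
  measurable_fun setT f -> (forall x, 0 <= f x) ->
  \int[nu]_x f x = \int[mu]_x (f x * (g x)%:E).
Proof.
move=> mg g0 nuE mf f0.
have ind E : measurable E ->
    \int[nu]_x (\1_E x)%:E = \int[mu]_x ((\1_E x)%:E * (g x)%:E).
  move=> mE; rewrite integral_indic// setIT nuE// integral_mkcond.
  apply: eq_integral => x _; rewrite patchE indicE.
  by case: ifPn => _; rewrite ?mul1e ?mul0e.
have sf (h : {nnsfun T >-> R}) :
    \int[nu]_x (h x)%:E = \int[mu]_x ((h x)%:E * (g x)%:E).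
  under [LHS]eq_integral do rewrite fimfunE -fsumEFin//.
  rewrite [LHS]ge0_integral_fsum//; last 2 first.
  - by move=> r; exact/measurable_EFinP/measurableT_comp.
  - by move=> n x _; rewrite EFinM nnfun_muleindic_ge0.
  under [RHS]eq_integral.
    move=> x xD; rewrite fimfunE -fsumEFin// muleC ge0_mule_fsumr; last first.
      by move=> r; rewrite EFinM nnfun_muleindic_ge0.
    over.
  rewrite [RHS]ge0_integral_fsum//; last 2 first.
  - move=> r; apply: emeasurable_funM; first exact/measurable_EFinP.
    exact/measurable_EFinP/measurableT_comp.
  - move=> n x _; rewrite EFinM mule_ge0//; last by rewrite nnfun_muleindic_ge0.
    by rewrite lee_fin.
  apply: eq_fsbigr => r _; rewrite integralZl_indic_nnsfun//= ind//.
  (* A nonnegative simple function takes no negative value, so both sides vanish for r < 0. *)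
  have [r0|r0] := leP 0%R r; last first.
    rewrite preimage_nnfun0// indic0.
    under eq_integral do rewrite mul0e.
    rewrite integral0 mule0; apply/esym; rewrite integral0_eq// => x _.
    by rewrite /cst/= mulr0 mule0.
  rewrite -ge0_integralZl//.
  - by apply: eq_integral => x _; rewrite EFinM muleA muleC.
  - by apply: emeasurable_funM; apply/measurable_EFinP => //; exact: measurable_indic.
  - by move=> x _; rewrite -EFinM lee_fin mulr_ge0.
pose f_ := nnsfun_approx measurableT mf.
transitivity (limn (fun n => \int[nu]_x (f_ n x)%:E)).
  rewrite -monotone_convergence//=.
  - apply: eq_integral => ? /[!inE] xD; apply/esym/cvg_lim => //=.
    exact: cvg_nnsfun_approx.
  - by move=> n; exact/measurable_EFinP/measurable_funTS.
  - by move=> n ? _; rewrite lee_fin.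
  - by move=> ? _ ? ? mn; rewrite lee_fin; exact/lefP/nd_nnsfun_approx.
under eq_fun do rewrite sf.
rewrite -monotone_convergence//=.
- apply: eq_integral => x _; apply/cvg_lim => //=.
  rewrite muleC; under eq_fun do rewrite muleC.
  by apply: cvgeZl => //; exact: cvg_nnsfun_approx.
- by move=> n; apply: emeasurable_funM; apply/measurable_EFinP => //; exact: measurable_funTS.
- by move=> n x _; rewrite -EFinM lee_fin mulr_ge0.
- move=> x _ m n mn; rewrite -!EFinM lee_fin ler_wpM2r//.
  exact/lefP/nd_nnsfun_approx.
Qed.

Lemma ge0_integral_normal (R : realType) (m s : R) (f : R -> \bar R) :
  measurable_fun setT f -> (forall x, 0 <= f x) ->
  \int[normal_prob m s]_x f x
  = \int[lebesgue_measure]_x (f x * (normal_pdf m s x)%:E).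
Proof.
move=> mf f0; apply: (@ge0_integral_density _ _ R lebesgue_measure (normal_prob m s) (normal_pdf m s)) => //.
  exact: measurable_normal_pdf.
by move=> x; exact: normal_pdf_ge0.
Qed.

(* Completing the square: the density of N(0, s^2) satisfies
   n(x) exp(c x) = exp(c^2 s^2 / 2) n(x - c s^2). *)
Lemma normal_exp_shift (R : realType) (c s : R) (f : R -> \bar R) : s != 0%R ->
  measurable_fun setT f -> (forall x, 0 <= f x) ->
  \int[normal_prob 0%R s]_x ((expR (c * x))%:E * f x)
  = (expR (c ^+ 2 * s ^+ 2 / 2))%:E
    * \int[normal_prob 0%R s]_x f (x + c * s ^+ 2)%R.
Proof.
move=> s0 mf f0.
have mfs h : measurable_fun [set: R] (fun x => f (x + h)%R).
  by apply: measurableT_comp => //; exact: measurable_funD.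
have me : measurable_fun [set: R] (fun x => (expR (c * x))%:E : \bar R).
  by apply/measurable_EFinP; apply: measurableT_comp => //; exact: measurable_funM.
have mn h : measurable_fun [set: R] (fun x => (normal_pdf 0 s (x + h)%R)%:E : \bar R).
  apply/measurable_EFinP; apply: (measurableT_comp (measurable_normal_pdf 0 s)).
  exact: measurable_funD.
have mn0 : measurable_fun [set: R] (fun x => (normal_pdf 0 s x)%:E : \bar R).
  by apply/measurable_EFinP; exact: measurable_normal_pdf.
have n0 x : 0 <= (normal_pdf 0 s x)%:E :> \bar R.
  by rewrite lee_fin normal_pdf_ge0.
rewrite !ge0_integral_normal//; last first.
- by move=> x; rewrite mule_ge0// lee_fin expR_ge0.
- exact: emeasurable_funM.
rewrite -ge0_integralZl//; last first.
- by move=> x _; exact: mule_ge0.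
- by apply: emeasurable_funM; [exact: mfs|exact: mn0].
rewrite -[LHS](ge0_integral_shift (c * s ^+ 2)%R); last 2 first.
- apply: emeasurable_funM; last exact: mn0.
  by apply: emeasurable_funM; [exact: me|exact: mf].
- by move=> x; rewrite mule_ge0// mule_ge0// lee_fin expR_ge0.
suff E (x : R) : ((expR (c * (x + c * s ^+ 2)) * normal_pdf 0 s (x + c * s ^+ 2))
    = expR (c ^+ 2 * s ^+ 2 / 2) * normal_pdf 0 s x)%R.
  apply: eq_integral => x _.
  by rewrite muleAC -EFinM E EFinM -muleA; congr (_ * _); exact: muleC.
have E : (expR (c * (x + c * s ^+ 2)) * normal_fun 0 s (x + c * s ^+ 2)
    = expR (c ^+ 2 * s ^+ 2 / 2) * normal_fun 0 s x)%R.
  rewrite /normal_fun -!expRD; congr expR.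
  by field; exact: s0.
by rewrite normal_pdfE//= mulrCA E mulrCA.
Qed.

(** The hypothesis on rectangles identifies the joint law of [X] and [Z] with the product of [N] and
    the law of [Z]; Tonelli then integrates [X] out while [Z] stays frozen. *)
Lemma ge0_integral_freezing d d1 d' (T : measurableType d)
    (S : measurableType d1) (Y : measurableType d')
    (R : realType) (P : probability T R) (N : probability S R)
    (X : T -> S) (Z : T -> Y) (f : S * Y -> \bar R) :
  measurable_fun setT X -> measurable_fun setT Z ->
  (forall A C, measurable A -> measurable C ->
     P (X @^-1` A `&` Z @^-1` C) = N A * P (Z @^-1` C)) ->
  measurable_fun setT f -> (forall z, 0 <= f z) ->
  \int[P]_w f (X w, Z w) = \int[P]_w \int[N]_x f (x, Z w).
Proof.
move=> mX mZ ind mf f0.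
have mXZ : measurable_fun setT (fun w => (X w, Z w)) by exact/measurable_fun_pair.
pose XZ : {mfun T >-> (S * Y)%type} :=
  HB.pack (fun w => (X w, Z w)) (isMeasurableFun.Build _ _ _ _ _ mXZ).
pose ZZ : {mfun T >-> Y} := HB.pack Z (isMeasurableFun.Build _ _ _ _ _ mZ).
have -> : \int[P]_w f (X w, Z w) = \int[distribution P XZ]_z f z.
  by rewrite ge0_integral_distribution.
transitivity (\int[N \x distribution P ZZ]_z f z).
  apply: eq_measure_integral => A mA _; apply/esym.
  apply: (@product_measure_unique _ _ S Y R N (distribution P ZZ) (distribution P XZ)) => //.
rewrite fubini_tonelli2//= ge0_integral_distribution//.
- exact: measurable_fun_fubini_tonelli_G.
- by move=> y; exact: integral_ge0.
Qed.

(** [Z] takes values in an arbitrary measurable space because it will be the identity of the sample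
    space, equipped with a coarser sigma-algebra. *)
Lemma ge0_integral_freezing_shift d d' (T : measurableType d)
    (Y : measurableType d') (R : realType) (P : probability T R) (c s : R)
    (X : T -> R) (Z : T -> Y) (f : R * Y -> \bar R) : s != 0%R ->
  measurable_fun setT X -> measurable_fun setT Z ->
  (forall A C, measurable A -> measurable C ->
     P (X @^-1` A `&` Z @^-1` C) = normal_prob 0%R s A * P (Z @^-1` C)) ->
  measurable_fun setT f -> (forall z, 0 <= f z) ->
  \int[P]_w ((expR (c * X w))%:E * f (X w, Z w))
  = (expR (c ^+ 2 * s ^+ 2 / 2))%:E
    * \int[P]_w f ((X w + c * s ^+ 2)%R, Z w).
Proof.
move=> s0 mX mZ ind mf f0.
pose N : probability (measurableTypeR R) R := normal_prob 0%R s.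
pose g1 (z : R * Y) := (expR (c * z.1))%:E * f z.
pose g2 (z : R * Y) := f ((z.1 + c * s ^+ 2)%R, z.2).
have mg1 : measurable_fun setT g1.
  apply: emeasurable_funM => //; apply/measurable_EFinP.
  by apply: measurableT_comp => //; apply: measurable_funM.
have g10 z : 0 <= g1 z by rewrite mule_ge0// lee_fin expR_ge0.
have mg2 : measurable_fun setT g2.
  apply: measurableT_comp => //; apply/measurable_fun_pair => /=.
    by apply: measurable_funD.
  exact: measurable_snd.
have g20 z : 0 <= g2 z by exact: f0.
rewrite (@ge0_integral_freezing _ _ _ T (measurableTypeR R) Y R P N X Z g1)//.
rewrite (@ge0_integral_freezing _ _ _ T (measurableTypeR R) Y R P N X Z g2)//.
rewrite -ge0_integralZl//; last 2 first.
- have mG := @measurable_fun_fubini_tonelli_G _ _ _ _ R N g2 mg2 g20.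
  exact: (measurableT_comp mG mZ).
- by move=> w _; exact: integral_ge0.
apply: eq_integral => w _.
have ms : measurable_fun [set: R] (fun x => f (x, Z w)).
  by apply: measurableT_comp => //; apply/measurable_fun_pair.
by rewrite (normal_exp_shift c s0 ms).
Qed.

End measure_lemmas.

(** * Shifting one increment *)

Section increments.
Context (R : realType) (d : measure_display) (T : measurableType d).
Variables (P : probability T R) (B : R -> T -> R).
Hypothesis hB : is_standard_BM P B.
Variables (mu delta : R).
Hypothesis delta_gt0 : 0 < delta.

Definition incr (k : nat) (w : T) : R :=
  B (k.+1%:R * delta) w - B (k%:R * delta) w.

Lemma measurable_BM s : 0 <= s -> measurable_fun setT (B s).
Proof. by have [_ _ h _] := hB; exact: h. Qed.

Lemma measurable_incr k : measurable_fun setT (incr k).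
Proof.
by apply: measurable_funB; apply: measurable_BM; rewrite mulr_ge0// ltW.
Qed.

Definition incr_rect (n : nat) (A : nat -> set R) : set T :=
  \bigcap_(i in `I_n) [set w | A i (incr i w)].

Lemma incr_rectE n A : (forall i, measurable (A i)) ->
  P (incr_rect n A) = (\prod_(i < n) normal_prob 0 (Num.sqrt delta) (A i))%E.
Proof.
move=> mA; have [_ _ _ h] := hB.
pose g (k : nat) := k%:R * delta.
have gS k : g k.+1 - g k = delta.
  by rewrite /g -natr1 mulrDl mul1r addrC addKr.
have g0 : g 0%N = 0 by rewrite /g mul0r.
have gl i : (i < n)%N -> g i < g i.+1 by rewrite -subr_gt0 gS.
have -> : incr_rect n A
  = \bigcap_(i in `I_n) [set w | A i (B (g i.+1) w - B (g i) w)] by [].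
rewrite (h n g A g0 gl (fun i _ => mA i)).
by apply: eq_bigr => i _; rewrite gS.
Qed.

(* Rectangles that do not constrain the k-th increment: a pi-system generating
   the sigma-algebra of the other increments. *)
Definition other_rects (n k : nat) : set (set T) :=
  [set E | exists A : nat -> set R,
     [/\ forall i, measurable (A i), A k = setT & E = incr_rect n A]].

Lemma measurable_incr_rect n A : (forall i, measurable (A i)) ->
  measurable (incr_rect n A).
Proof.
move=> mA; apply: fin_bigcap_measurable => [|i _]; first exact: finite_II.
by rewrite -[X in measurable X]setTI; exact: measurable_incr.
Qed.

Lemma other_rects_measurable n k : other_rects n k `<=` measurable.
Proof. by move=> _ [A [mA _ ->]]; exact: measurable_incr_rect. Qed.

Lemma other_rects_setI n k : setI_closed (other_rects n k).
Proof.
move=> _ _ [A1 [mA1 A1k ->]] [A2 [mA2 A2k ->]].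
exists (fun i => A1 i `&` A2 i); split.
- by move=> i; exact: measurableI.
- by rewrite A1k A2k setTI.
- by rewrite /incr_rect bigcapI.
Qed.

Lemma other_rectsT n k : other_rects n k setT.
Proof.
by exists (fun=> setT); split => //; apply/seteqP; split.
Qed.

Notation othersT n k := (g_sigma_algebraType (other_rects n k)).

(** For fixed [S] both sides are finite measures in [C]; they agree on the pi-system
    [other_rects n k], hence on the sigma-algebra that it generates. *)
Lemma incr_indep n k (S : set R) (C : set T) : (k < n)%N -> measurable S ->
  <<s other_rects n k >> C ->
  P (incr k @^-1` S `&` C) = (normal_prob 0 (Num.sqrt delta) S * P C)%E.
Proof.
move=> kn mS.
have mD : measurable (incr k @^-1` S).
  by rewrite -[X in measurable X]setTI; exact: measurable_incr.
set N := normal_prob 0 (Num.sqrt delta).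
have N0 : 0 <= fine (N S) by rewrite fine_ge0.
pose m1 : {measure set T -> \bar R} := mrestr P mD.
pose m2 : {measure set T -> \bar R} := mscale (NngNum N0) P.
have m2E E : m2 E = (N S * P E)%E.
  by rewrite /m2/= /mscale/= fineK// fin_num_measure.
move=> sC; rewrite setIC -m2E.
apply: (g_sigma_algebra_measure_unique (other_rects n k)
  (@other_rects_measurable n k) (fun=> setT) _ _ m1 m2) => //.
- by move=> _; exact: other_rectsT.
- by apply/seteqP; split => // x _; exists 0%N.
- exact: other_rects_setI.
- move=> _ [A [mA Ak ->]]; rewrite m2E incr_rectE// /m1/= /mrestr.
  (* The slot k, left free by [A k = setT], receives the constraint [S], so the intersection is
     again a rectangle. *)
  pose A' i := if i == k then S else A i.
  have mA' i : measurable (A' i) by rewrite /A'; case: ifP.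
  have -> : incr_rect n A `&` incr k @^-1` S = incr_rect n A'.
    apply/seteqP; split => w.
      move=> [h hk] i /= ni; rewrite /A'; case: eqP => [->//|_]; exact: h.
    move=> h; split; last by have := h k kn; rewrite /A' eqxx.
    move=> i /= ni; have := h i ni; rewrite /A'/=; case: eqP => // ->.
    by rewrite Ak.
  rewrite incr_rectE// (bigD1 (Ordinal kn))//= /A' eqxx.
  rewrite [in RHS](bigD1 (Ordinal kn))//= Ak probability_setT mul1e.
  congr (_ * _)%E; apply: eq_bigr => i /negbTE.
  by rewrite -val_eqE/= => ->.
- move=> _; rewrite /m1/= /mrestr setTI.
  by rewrite (le_lt_trans (probability_le1 _ _))// ltry.
Qed.

Lemma measurable_to_others n k :
  measurable_fun setT (idfun : T -> othersT n k).
Proof.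
move=> _ C sC; rewrite setTI.
exact: (smallest_sub (@sigma_algebra_measurable _ T)
  (@other_rects_measurable n k)).
Qed.

Lemma measurable_incr_others n k j : (j < n)%N -> j != k ->
  measurable_fun [set: othersT n k] (incr j : othersT n k -> R).
Proof.
move=> jn jk _ S mS; rewrite setTI; apply: sub_sigma_algebra.
exists (fun i => if i == j then S else setT); split.
- by move=> i; case: ifP.
- by rewrite eq_sym (negbTE jk).
- apply/seteqP; split => w.
    by move=> h i /= _; case: eqP => // ->.
  by move=> /(_ j jn) /=; rewrite eqxx.
Qed.

(** Freezing with [Z] the identity into [othersT n k]: the second argument of [f] is the outcome
    itself, seen only through the increments other than the k-th. The constant is exp(c^2 s^2 / 2)
    with c = 2 and s^2 = delta. *)
Lemma incr_exp_shift n k (f : R * othersT n k -> \bar R) : (k < n)%N ->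
  measurable_fun setT f -> (forall z, 0 <= f z)%E ->
  (\int[P]_w ((expR (2 * incr k w))%:E * f (incr k w, w))
  = (expR (2 * delta))%:E * \int[P]_w f ((incr k w + 2 * delta)%R, w))%E.
Proof.
move=> kn mf f0.
have ind A C : measurable A -> measurable C ->
    P (incr k @^-1` A `&` (idfun : T -> othersT n k) @^-1` C)
    = (normal_prob 0 (Num.sqrt delta) A * P ((idfun : T -> othersT n k) @^-1` C))%E.
  by move=> mA mC; exact: (@incr_indep n k).
have s0 : Num.sqrt delta != 0 by rewrite gt_eqF// sqrtr_gt0.
have ss : Num.sqrt delta ^+ 2 = delta by rewrite sqr_sqrtr// ltW.
rewrite (@ge0_integral_freezing_shift _ _ _ _ R P 2 (Num.sqrt delta) (incr k)
  (idfun : T -> othersT n k) f s0 (measurable_incr k)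
  (@measurable_to_others n k) ind mf f0) ss.
by congr ((expR _)%:E * _)%E; field.
Qed.

Definition walk (k : nat) (w : T) : R := B (k%:R * delta) w + mu * (k%:R * delta).

(** A Riemann sum for A_t taken at left endpoints, so that [walkA k.+1] does not involve the k-th
    increment: shifting that increment by 2 delta leaves [walkA k.+1] alone and multiplies
    [walkA n - walkA k.+1] by e^(4 delta). *)
Definition walkA (k : nat) (w : T) : R :=
  delta * \sum_(j < k) expR (2 * walk j w).

Lemma measurable_walk k : measurable_fun setT (walk k).
Proof.
by apply: measurable_funD => //; apply: measurable_BM; rewrite mulr_ge0// ltW.
Qed.

Lemma measurable_walkA k : measurable_fun setT (walkA k).
Proof.
apply: measurable_funM => //; apply: measurable_sum => i.
apply: measurableT_comp => //; apply: measurable_funM => //.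
exact: measurable_walk.
Qed.

Lemma walk_sum k w : walk k w = \sum_(i < k) incr i w + mu * (k%:R * delta).
Proof.
have [B0 _ _ _] := hB.
rewrite /walk; congr (_ + _); elim: k => [|k IHk]; first by rewrite mul0r B0 big_ord0.
by rewrite big_ord_recr/= -IHk /incr addrC subrK.
Qed.

Lemma walkS k w : walk k.+1 w = walk k w + incr k w + mu * delta.
Proof.
rewrite /walk /incr -natr1 mulrDl mul1r mulrDr.
by set b1 := B _ w; set b2 := B _ w; ring.
Qed.

Lemma walkAS k w : walkA k.+1 w = walkA k w + delta * expR (2 * walk k w).
Proof. by rewrite /walkA big_ord_recr/= mulrDr. Qed.

(* Completing the square in the k-th increment turns its weight e^(2 xi) into a
   shift of the walk from time k.+1 on. *)
Lemma walk_shift n k (Phi : R -> R -> R) : (k < n)%N ->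
  measurable_fun setT (fun p : R * R => Phi p.1 p.2) ->
  (forall b a, 0 <= Phi b a) ->
  (\int[P]_w (expR (2 * walk k.+1 w) * Phi (walk n w) (walkA n w))%:E
  = (expR (2 * (1 + mu) * delta))%:E *
    \int[P]_w (expR (2 * walk k w) * Phi (walk n w + 2 * delta)
       (walkA k.+1 w + expR (4 * delta) * (walkA n w - walkA k.+1 w)))%:E)%E.
Proof.
move=> kn mPhi Phi0.
(* The contribution [bo] of the other increments is separated from the k-th one, which enters at
   times after k. In this form everything is a measurable function of the k-th increment and of the
   point of [othersT n k]. *)
pose bo (j : nat) (w : othersT n k) : R :=
  \sum_(i < j | i != k :> nat) incr i w + mu * (j%:R * delta).
pose bx (j : nat) (z : R * othersT n k) : R := bo j z.2 + (k < j)%:R * z.1.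
pose ax (j : nat) (z : R * othersT n k) : R :=
  delta * \sum_(i < j) expR (2 * bx i z).
have mbo j : (j <= n)%N -> measurable_fun [set: othersT n k] (bo j).
  move=> jn; apply: measurable_funD => //.
  under eq_fun do rewrite big_mkcond/=.
  apply: measurable_sum => i; case: (boolP (i != k :> nat)) => ik; last exact: measurable_cst.
  by apply: measurable_incr_others => //; exact: leq_trans jn.
have mbx j : (j <= n)%N -> measurable_fun setT (bx j).
  move=> jn; apply: measurable_funD.
    by apply: measurableT_comp; [exact: mbo|exact: measurable_snd].
  by apply: measurable_funM.
have max : measurable_fun setT (ax n).
  apply: measurable_funM => //; apply: measurable_sum => i.
  apply: measurableT_comp => //; apply: measurable_funM => //.
  by apply: mbx; exact: ltnW.
have bxE j w : bx j (incr k w, w) = walk j w.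
  rewrite walk_sum /bx /bo/= addrAC; congr (_ + _).
  have [kj|jk] := ltnP k j.
    by rewrite mul1r [RHS](bigD1 (Ordinal kj))//= addrC.
  rewrite mul0r addr0; apply: eq_bigl => i.
  by rewrite neq_ltn (leq_trans (ltn_ord i) jk).
have axE w : ax n (incr k w, w) = walkA n w.
  by rewrite /ax /walkA; congr (_ * _); apply: eq_bigr => i _; rewrite bxE.
have bxS j w : bx j (incr k w + 2 * delta, w)
    = walk j w + (k < j)%:R * (2 * delta).
  by rewrite -bxE /bx/= mulrDr addrA.
have axS w : ax n (incr k w + 2 * delta, w)
    = walkA k.+1 w + expR (4 * delta) * (walkA n w - walkA k.+1 w).
  rewrite /ax /walkA -mulrBr mulrCA -mulrDr; congr (_ * _).
  rewrite -!(big_mkord xpredT (fun i => expR (2 * _ i _))).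
  rewrite (@big_cat_nat _ _ _ k.+1)//= [in RHS](@big_cat_nat _ _ _ k.+1 0 n)//=.
  rewrite [X in expR (4 * delta) * X]addrAC subrr add0r; congr (_ + _).
    apply: eq_big_nat => i /andP[_ ik]; rewrite bxS.
    by rewrite ltnNge -ltnS ik mul0r addr0.
  rewrite mulr_sumr; apply: eq_big_nat => i /andP[ki _].
  rewrite bxS ki mul1r mulrDr expRD mulrC; congr (expR _ * _).
  by ring.
(* Without its k-th increment, [walk k.+1] is [walk k + mu * delta], and [bx k] ignores that
   increment: the weight e^(2 xi) is thus isolated in front of [f]. *)
pose f (z : R * othersT n k) : \bar R :=
  (expR (2 * (bx k z + mu * delta)) * Phi (bx n z) (ax n z))%:E.
have mf : measurable_fun setT f.
  apply/measurable_EFinP; apply: measurable_funM.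
    apply: measurableT_comp => //; apply: measurable_funM => //.
    by apply: measurable_funD => //; apply: mbx; exact: ltnW.
  apply: (measurableT_comp mPhi (g := fun z => (bx n z, ax n z))).
  by apply/measurable_fun_pair => //; exact: mbx.
have f0 z : (0 <= f z)%E by rewrite lee_fin mulr_ge0// expR_ge0.
transitivity (\int[P]_w ((expR (2 * incr k w))%:E * f (incr k w, w)))%E.
  apply: eq_integral => w _; rewrite /f !bxE axE -EFinM mulrA -expRD walkS.
  by congr ((expR _ * _)%:E); ring.
rewrite (incr_exp_shift kn mf f0).
pose c := expR (2 * mu * delta).
transitivity ((expR (2 * delta))%:E * (c%:E *
    \int[P]_w (expR (2 * walk k w) * Phi (walk n w + 2 * delta)
       (walkA k.+1 w + expR (4 * delta) * (walkA n w - walkA k.+1 w)))%:E))%E.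
  congr (_ * _)%E; rewrite -ge0_integralZl//; last 3 first.
  - apply/measurable_EFinP; apply: measurable_funM.
      apply: measurableT_comp => //; apply: measurable_funM => //.
      exact: measurable_walk.
    apply: (measurableT_comp mPhi (g := fun w => (walk n w + 2 * delta,
      walkA k.+1 w + expR (4 * delta) * (walkA n w - walkA k.+1 w)))).
    apply/measurable_fun_pair => /=.
      by apply: measurable_funD => //; exact: measurable_walk.
    apply: measurable_funD; first exact: measurable_walkA.
    apply: measurable_funM => //.
    by apply: measurable_funB; exact: measurable_walkA.
  - by move=> w _; rewrite lee_fin mulr_ge0// expR_ge0.
  - by rewrite lee_fin expR_ge0.
  apply: eq_integral => w _; rewrite /f !bxS axS ltnn mul0r addr0 kn mul1r.
  rewrite -EFinM mulrA /c -expRD; congr ((expR _ * _)%:E).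
  by ring.
rewrite muleA -EFinM -expRD; congr ((expR _)%:E * _)%E.
by ring.
Qed.

End increments.

(** * Riemann sums of continuous paths *)

Section riemann_sums.
Context (R : realType).
Notation leb := (@lebesgue_measure R).

(** Brownian paths are continuous only on the half-line; freezing them at their value in 0 for
    negative times gives functions continuous on the whole line, without changing any integral over
    [0, t]. *)
Lemma continuous_max0 (f : R -> R) :
  {within `[0, +oo[, continuous f} -> continuous (fun x : R => f (Num.max 0 x)).
Proof.
move=> /subspace_continuousP cf x.
have mx : `[0, +oo[%classic (Num.max 0 x : R).
  by rewrite /= in_itv/= andbT le_max lexx.
apply: (@cvg_comp _ _ _ (fun x : R => Num.max 0 x) f _ _ _ _ (cf _ mx)).
move=> U; rewrite /within/= => hU.
have mc : Num.max 0 y @[y --> x] --> Num.max 0 x.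
  by apply: continuous_max; [exact: cvg_cst|exact: cvg_id].
suff : \forall y \near nbhs x, U (Num.max 0 y) by [].
have : \forall y \near nbhs x,
  `[0, +oo[%classic (Num.max 0 y) -> U (Num.max 0 y) := mc _ hU.
apply: filterS => y; apply.
by rewrite /= in_itv/= andbT le_max lexx.
Qed.

Lemma heine (f : R -> R) (t e : R) : continuous f -> 0 < e ->
  exists2 h, 0 < h & forall x y, 0 <= x <= t -> `|y - x| < h ->
    `|f y - f x| < e.
Proof.
move=> cf e0.
have /compact_near_coveringP K := @segment_compact R 0 t.
(* Compactness merges the pointwise moduli of continuity into one that serves all x in the segment;
   y is allowed to leave it. *)
have := K R (0^'+) (fun i x => forall y, `|y - x| < i -> `|f y - f x| < e) _ _.
case.
  move=> x _.
  have /cvgrPdist_lt/(_ (e / 2)) := cf x.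
  rewrite divr_gt0// => /(_ isT) /nbhs_ballP[h /= h0 hf].
  exists (ball x (h / 2), [set i | i < h / 2]).
    split; first by apply: nbhsx_ballx; rewrite divr_gt0.
    by apply: nbhs_right_lt; rewrite divr_gt0.
  move=> [x' i] /= [xx' ih] y yx'.
  have hx : `|x - x'| < h / 2 := xx'.
  have h1 : `|f x - f x'| < e / 2.
    by apply: hf; rewrite /ball/= (lt_trans hx)//; clear -h0; lra.
  have h2 : `|f x - f y| < e / 2.
    apply: hf; rewrite /ball/= [h]splitr (le_lt_trans (ler_distD x' _ _))//.
    by rewrite ltrD// distrC (lt_trans yx').
  rewrite [e]splitr (le_lt_trans (ler_distD (f x) _ _))//.
  by rewrite ltrD// distrC.
move=> h /= h0 H; exists (h / 2); first by rewrite divr_gt0.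
move=> x y xt; apply: (H (h / 2)) => //=.
- rewrite sub0r normrN gtr0_norm ?divr_gt0//.
  by rewrite ltr_pdivrMr// ltr_pMr// ltr1n.
- by rewrite divr_gt0.
Qed.

Lemma riemann_sum_dist (f : R -> R) (t e h : R) (n : nat) :
  continuous f -> 0 < h -> n%:R * h <= t ->
  (forall x y, 0 <= x <= t -> `|y - x| <= h -> `|f y - f x| <= e) ->
  `|Rintegral leb `[0, n%:R * h] f - h * \sum_(k < n) f (k%:R * h)|
    <= n%:R * h * e.
Proof.
move=> cf h0 nt H.
have intg (g : R -> R) a b : continuous g -> leb.-integrable `[a, b] (EFin \o g).
  move=> cg; apply: continuous_compact_integrable; first exact: segment_compact.
  exact: continuous_subspaceT.
elim: n nt => [|n IHn] nt.
  by rewrite !mul0r set_itv1 Rintegral_set1 big_ord0 mulr0 subrr normr0.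
set a := n%:R * h; set b := n.+1%:R * h.
have a0 : 0 <= a by rewrite mulr_ge0// ltW.
have bE : b = a + h by rewrite /b -natr1 mulrDl mul1r.
have ab : a <= b by rewrite bE lerDl ltW.
have at' : a <= t by rewrite (le_trans ab).
have iab (g : R -> R) : continuous g -> leb.-integrable `]a, b] (EFin \o g).
  by move=> cg; apply: integrableS (intg g a b cg) => //; exact: subset_itv_oc_cc.
have icst (c : R) : leb.-integrable `]a, b] (EFin \o (fun=> c)).
  by apply: iab => y; exact: cvg_cst.
have Icst (c : R) : Rintegral leb `]a, b] (fun=> c) = h * c.
  rewrite Rintegral_cst//= lebesgue_measure_itv/= lte_fin bE ltrDl h0 -EFinB/=.
  by ring.
have -> : Rintegral leb `[0, b] f
    = Rintegral leb `[0, a] f + Rintegral leb `]a, b] f.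
  have := @Rintegral_itvB _ f (BLeft 0) (BRight b) a (intg f 0 b cf).
  by rewrite !bnd_simp => /(_ a0 ab) <-; rewrite addrC subrK.
have -> : Rintegral leb `]a, b] f
    = Rintegral leb `]a, b] (fun y => f y - f a) + h * f a.
  rewrite RintegralB//; last exact: iab.
  by rewrite Icst; ring.
rewrite big_ord_recr/= -/a mulrDr.
have E (I J S c : R) : I + (J + c) - (S + c) = (I - S) + J by ring.
rewrite {}E.
rewrite (le_trans (ler_normD _ _))// [X in _ <= X * e]bE mulrDl lerD//.
  exact: IHn.
have iJ : leb.-integrable `]a, b] (EFin \o (fun y => f y - f a)).
  by apply: iab => y; apply: cvgB; [exact: cf|exact: cvg_cst].
apply: (le_trans (le_normr_Rintegral _ iJ)) => //.
rewrite -Icst.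
apply: le_Rintegral => //.
- exact: (integrable_norm iJ).
- move=> y; rewrite /= in_itv/= => /andP[ay yb]; apply: H.
    by rewrite a0 at'.
  by rewrite gtr0_norm ?subr_gt0// lerBlDl -bE.
Qed.

Lemma cvg_riemann_sum (f : R -> R) (t : R) : continuous f -> 0 < t ->
  (t / n.+1%:R * \sum_(k < n.+1) f (k%:R * (t / n.+1%:R))) @[n --> \oo]
    --> Rintegral leb `[0, t] f.
Proof.
move=> cf t0; apply/cvgrPdist_le => e e0.
have et0 : 0 < e / t by rewrite divr_gt0.
have [h h0 H] := heine t cf et0.
have := @cvg_harmonic R => /cvgrPdist_lt/(_ (h / t)).
rewrite divr_gt0// => /(_ isT); apply: filterS => n.
rewrite sub0r normrN /harmonic/= gtr0_norm ?invr_gt0// ltr_pdivlMr// => hn.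
set d := t / n.+1%:R.
have d0 : 0 < d by rewrite divr_gt0.
have nd : n.+1%:R * d = t by rewrite mulrC divfK.
have := @riemann_sum_dist f t (e / t) d n.+1 cf d0.
rewrite nd [t * (e / t)]mulrC divfK ?gt_eqF// => /(_ (lexx _)); apply.
move=> x y xt yx; apply/ltW/H => //; rewrite (le_lt_trans yx)//.
by rewrite /d mulrC.
Qed.

End riemann_sums.

(** * First-order expansion of the shifted sums *)

Section flow.
Context (R : realType).
Variables (Phi Phi1 Phi2 : R -> R -> R) (c C L : R).
Hypothesis dPhi : forall (u v : R -> R) (s du dv : R),
  is_derive s 1 u du -> is_derive s 1 v dv -> 0 < v s ->
  is_derive s 1 (fun x => Phi (u x) (v x))
    (Phi1 (u s) (v s) * du + Phi2 (u s) (v s) * dv).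
Hypothesis bPhi : forall b a, 0 < a ->
  [/\ `|Phi b a| <= C, `|Phi1 b a| <= C & `|Phi2 b a| <= C].
Hypothesis sPhi : forall b a, L < a ->
  [/\ Phi b a = 0, Phi1 b a = 0 & Phi2 b a = 0].

(** The derivative in z of [expR (c * z) * Phi (b + 2 * z) (a + expR (4 * z) * D)] is [flowU],
    coming from the prefactor and the first argument, plus D times [flowV], coming from the second
    argument. *)
Definition flowU (b : R) (p : R * R) : R :=
  expR (c * p.1) * (c * Phi (b + 2 * p.1) p.2 + 2 * Phi1 (b + 2 * p.1) p.2).

Definition flowV (b : R) (p : R * R) : R :=
  4 * expR (c * p.1) * expR (4 * p.1) * Phi2 (b + 2 * p.1) p.2.

Lemma flow_mean_value (b a D s : R) : 0 < a -> 0 <= D -> 0 < s ->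
  exists2 z, 0 <= z <= s &
    expR (c * s) * Phi (b + 2 * s) (a + expR (4 * s) * D) - Phi b (a + D)
    = s * (flowU b (z, a + expR (4 * z) * D)
           + D * flowV b (z, a + expR (4 * z) * D)).
Proof.
move=> a0 D0 s0.
pose f z := expR (c * z) * Phi (b + 2 * z) (a + expR (4 * z) * D).
pose df z := flowU b (z, a + expR (4 * z) * D)
             + D * flowV b (z, a + expR (4 * z) * D).
have dexp (k z : R) : is_derive z 1 (fun x => expR (k * x)) (k * expR (k * z)).
  have -> : (fun x => expR (k * x)) = expR \o (fun x => k * x) by [].
  by apply: is_derive_eq; rewrite /GRing.scale/= mulr1 mulrC.
have df_ (z : R) : is_derive z 1 f (df z).
  have d1 : is_derive z 1 (fun x => b + 2 * x) 2.
    by apply: is_derive_eq; rewrite /GRing.scale/=; ring.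
  have d2 : is_derive z 1 (fun x => a + expR (4 * x) * D) (4 * expR (4 * z) * D).
    have de := dexp 4 z.
    by apply: is_derive_eq; rewrite /GRing.scale/=; ring.
  have v0 : 0 < a + expR (4 * z) * D by rewrite ltr_wpDr// mulr_ge0// expR_ge0.
  have d3 := dPhi d1 d2 v0; have d4 := dexp c z.
  apply: is_derive_eq; rewrite /GRing.scale/= /df /flowU /flowV/=.
  by ring.
have [|z] := @MVT_segment R f df 0 s (ltW s0) (fun z _ => df_ z).
  apply: continuous_subspaceT => z.
  by apply/differentiable_continuous/derivable1_diffP; have [] := df_ z.
rewrite in_itv/= => zs E; exists z => //.
by move: E; rewrite /f !mulr0 !expR0 !mul1r addr0 subr0 => ->; rewrite mulrC.
Qed.

Variables (e : nat -> R) (s : R) (n : nat).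
Hypothesis e0 : forall k, 0 < e k.
Hypothesis s0 : 0 < s.

Let a (k : nat) := \sum_(j < k) e j.

Let aS k : a k.+1 = a k + e k. Proof. by rewrite /a big_ord_recr. Qed.

Let a_ge0 k : 0 <= a k. Proof. by apply: sumr_ge0 => i _; exact: ltW. Qed.

Let aS_gt0 k : 0 < a k.+1. Proof. by rewrite aS ltr_wpDl. Qed.

Let a_le k m : (k <= m)%N -> a k <= a m.
Proof.
move=> km; rewrite -(subnKC km) /a big_split_ord/= lerDl.
by apply: sumr_ge0 => i _; exact: ltW.
Qed.

(** The left-hand side sums [e k * e j] over all pairs k < j < m, which is half of the squared total
    minus its diagonal. *)
Let cross m : \sum_(k < m) e k * (a m - a k.+1)
  = (a m ^+ 2 - \sum_(k < m) e k ^+ 2) / 2.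
Proof.
elim: m => [|m IHm]; first by rewrite /a !big_ord0 expr0n/= subrr mul0r.
rewrite !big_ord_recr/= subrr mulr0 addr0.
under eq_bigr => k _ do rewrite aS addrAC mulrDr.
rewrite big_split/= IHm -mulr_suml -/(a m) aS.
by set S := \sum_(k < m) _; field.
Qed.

(** For [e k = s * expR (2 * walk k)] the partial sums [a k] are [walkA k], and the k-th term
    compares [Phi] after and before the shift of the k-th increment, weighted as in [walk_shift]. *)
Definition flow_sum (b : R) := \sum_(k < n) e k *
  (expR (c * s) * Phi (b + 2 * s) (a k.+1 + expR (4 * s) * (a n - a k.+1))
   - Phi b (a n)).

Lemma flow_sum_mean (b : R) : exists z : nat -> R, forall k, (k < n)%N ->
  0 <= z k <= s /\
  expR (c * s) * Phi (b + 2 * s) (a k.+1 + expR (4 * s) * (a n - a k.+1))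
   - Phi b (a n)
  = s * (flowU b (z k, a k.+1 + expR (4 * z k) * (a n - a k.+1))
         + (a n - a k.+1) * flowV b (z k, a k.+1 + expR (4 * z k) * (a n - a k.+1))).
Proof.
have H k : exists z, (k < n)%N ->  0 <= z <= s /\
  expR (c * s) * Phi (b + 2 * s) (a k.+1 + expR (4 * s) * (a n - a k.+1))
   - Phi b (a n)
  = s * (flowU b (z, a k.+1 + expR (4 * z) * (a n - a k.+1))
         + (a n - a k.+1) * flowV b (z, a k.+1 + expR (4 * z) * (a n - a k.+1))).
  have [kn|] := boolP (k < n)%N; last by exists 0.
  have D0 : 0 <= a n - a k.+1 by rewrite subr_ge0 a_le.
  have [z zs E] := @flow_mean_value b (a k.+1) (a n - a k.+1) s (aS_gt0 k) D0 s0.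
  exists z => _; split => //; rewrite -E.
  by congr (_ - Phi b _); rewrite addrC subrK.
by have [z hz] := choice H; exists z.
Qed.

Let ak_bounds k z : (k < n)%N -> 0 <= z <= s ->
  a n <= a k.+1 + expR (4 * z) * (a n - a k.+1) <= expR (4 * s) * a n.
Proof.
move=> kn /andP[z0 zs].
have D0 : 0 <= a n - a k.+1 by rewrite subr_ge0 a_le.
have e1 : 1 <= expR (4 * z) by rewrite -expR0 ler_expR mulr_ge0.
have e2 : expR (4 * z) <= expR (4 * s) by rewrite ler_expR ler_wpM2l.
have := aS_gt0 k; nra.
Qed.

(** Along the flow the second argument of [Phi] never falls below [a n]. If [a n] exceeds [L], all
    terms vanish; otherwise the weights add up to at most [L]. The bound divided by [s] is therefore
    the same for all grids, as dominated convergence demands. *)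
Lemma flow_sum_bound (b t : R) : s <= t ->
  `|flow_sum b| <= s * (`|L| * (expR (`|c| * t) * (`|c| * C + 2 * C)
     + `|L| * (4 * expR (`|c| * t) * expR (4 * t) * C))).
Proof.
move=> st.
have C0 : 0 <= C by have [h _ _] := bPhi 0 (@ltr01 R); exact: le_trans h.
have t0 : 0 < t by exact: lt_le_trans st.
have [z hz] := flow_sum_mean b.
set M := (X in _ <= s * (_ * X)).
have M0 : 0 <= M.
  by rewrite addr_ge0// mulr_ge0 ?expR_ge0 ?addr_ge0 ?mulr_ge0 ?expR_ge0.
have [anL|Lan] := leP (a n) L; last first.
  have RHS0 : 0 <= s * (`|L| * M) by rewrite mulr_ge0 ?(ltW s0)// mulr_ge0.
  rewrite /flow_sum big1 ?normr0// => k _.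
  have [zs ->] := hz k (ltn_ord k).
  have /andP[h _] := ak_bounds (ltn_ord k) zs.
  have [h0 h1 h2] := sPhi (b + 2 * z k) (lt_le_trans Lan h).
  by rewrite /flowU /flowV/= h0 h1 h2 !(mulr0, addr0).
rewrite (le_trans (ler_norm_sum _ _ _))//.
apply: (@le_trans _ _ (\sum_(k < n) e k * (s * M))).
  apply: ler_sum => k _.
  have [/andP[z0 zs] ->] := hz k (ltn_ord k).
  rewrite normrM (gtr0_norm (e0 k)) ler_wpM2l ?(ltW (e0 k))//.
  rewrite normrM (gtr0_norm s0) ler_wpM2l ?(ltW s0)//.
  set ak := a k.+1 + _.
  have ak0 : 0 < ak.
    rewrite ltr_wpDr ?aS_gt0// mulr_ge0 ?expR_ge0// subr_ge0.
    by apply: a_le.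
  have [h0 h1 h2] := bPhi (b + 2 * z k) ak0.
  have ec : expR (c * z k) <= expR (`|c| * t).
    rewrite ler_expR (le_trans (ler_norm _))// normrM ler_wpM2l//.
    by rewrite ger0_norm// (le_trans zs).
  have e4 : expR (4 * z k) <= expR (4 * t).
    by rewrite ler_expR ler_wpM2l// (le_trans zs).
  rewrite (le_trans (ler_normD _ _))// lerD//.
    rewrite /flowU/= normrM ger0_norm ?expR_ge0//.
    rewrite ler_pM ?expR_ge0// (le_trans (ler_normD _ _))// !normrM.
    by rewrite lerD// ?ler_wpM2l// ger0_norm// ler_wpM2l.
  rewrite normrM ler_pM//.
    have aa : a k.+1 <= a n by apply: a_le.
    rewrite ger0_norm ?subr_ge0// (le_trans _ (ler_norm L))//.
    by rewrite (le_trans _ anL)// gerBl ltW.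
  rewrite /flowV/= !normrM !(ger0_norm (expR_ge0 _)) ger0_norm//.
  rewrite ler_pM ?mulr_ge0 ?expR_ge0//.
  by rewrite ler_pM ?mulr_ge0 ?expR_ge0// ler_wpM2l.
rewrite -mulr_suml -/(a n) mulrCA ler_wpM2l ?(ltW s0)// ler_wpM2r//.
by rewrite (le_trans anL)// ler_norm.
Qed.

(** All intermediate points lie between [a n] and [expR (4 * s) * a n], hence within eta of [A].
    Freezing [flowU] and [flowV] at [(0, A)] costs eps and [a n * eps] per unit of weight, and
    [cross] evaluates what remains. *)
Lemma flow_sum_dist (b A eps eta : R) : 0 <= eps ->
  s <= eta -> `|a n - A| <= eta -> `|expR (4 * s) * a n - A| <= eta ->
  (forall z x, `|z| <= eta -> `|x - A| <= eta ->
     `|flowU b (z, x) - flowU b (0, A)| <= eps /\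
     `|flowV b (z, x) - flowV b (0, A)| <= eps) ->
  `|flow_sum b - s * (a n * flowU b (0, A) + (a n ^+ 2 - \sum_(k < n) e k ^+ 2) / 2
      * flowV b (0, A))| <= s * (a n * (eps * (1 + a n))).
Proof.
move=> eps0 seta ha hea UV.
have [z hz] := flow_sum_mean b.
have -> : s * (a n * flowU b (0, A)
    + (a n ^+ 2 - \sum_(k < n) e k ^+ 2) / 2 * flowV b (0, A))
  = \sum_(k < n) e k * (s * (flowU b (0, A) + (a n - a k.+1) * flowV b (0, A))).
  rewrite -cross {1}/a !mulr_suml -big_split/= mulr_sumr.
  by apply: eq_bigr => k _; ring.
rewrite -sumrB (le_trans (ler_norm_sum _ _ _))//.
rewrite mulrCA {1}/a mulr_suml; apply: ler_sum => k _.
have [zs ->] := hz k (ltn_ord k).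
rewrite -mulrBr normrM (gtr0_norm (e0 k)) ler_wpM2l ?(ltW (e0 k))//.
rewrite -mulrBr normrM (gtr0_norm s0) ler_wpM2l ?(ltW s0)//.
have /andP[h1 h2] := ak_bounds (ltn_ord k) zs.
set x := a k.+1 + _ in h1 h2 *.
have zeta : `|z k| <= eta.
  by case/andP: zs => z0 zs; rewrite ger0_norm// (le_trans zs).
have xeta : `|x - A| <= eta.
  by move: ha hea; rewrite !ler_norml; lra.
have [hU hV] := UV _ _ zeta xeta.
have aa : a k.+1 <= a n by apply: a_le.
have a1 := aS_gt0 k.
set D := a n - a k.+1.
have -> : flowU b (z k, x) + D * flowV b (z k, x)
  - (flowU b (0, A) + D * flowV b (0, A))
  = (flowU b (z k, x) - flowU b (0, A))
    + D * (flowV b (z k, x) - flowV b (0, A)) by ring.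
have D0 : 0 <= D by rewrite subr_ge0.
have Dn : D <= a n by rewrite gerBl ltW.
rewrite (le_trans (ler_normD _ _))// normrM (ger0_norm D0).
rewrite (@le_trans _ _ (eps + a n * eps))//; last by rewrite mulrDr mulr1 mulrC.
by rewrite lerD// ler_pM.
Qed.

End flow.

(** * Integration by parts for the exponential functional *)

Section expBM.
Context (R : realType) (d : measure_display) (T : measurableType d).
Variables (P : probability T R) (B : R -> T -> R).
Hypothesis hB : is_standard_BM P B.
Variables (mu t : R).
Hypothesis t_gt0 : 0 < t.
Notation leb := (@lebesgue_measure R).

Let dn (n : nat) : R := t / n.+1%:R.

Let dn_gt0 n : 0 < dn n. Proof. by rewrite divr_gt0. Qed.

Let dn_le n : dn n <= t.
Proof. by rewrite ler_pdivrMr// ler_peMr ?(ltW t_gt0)// ler1n. Qed.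

Let cvg_dn : dn n @[n --> \oo] --> 0.
Proof.
rewrite -(mulr0 t); apply: cvgM; first exact: cvg_cst.
exact: cvg_harmonic.
Qed.

Let bm (c : R) (w : T) (u : R) : R := expR (c * (B (Num.max 0 u) w + mu * u)).

Let continuous_bm c w : continuous (bm c w).
Proof.
have [_ cB _ _] := hB.
move=> u; apply: (@cvg_comp _ _ _
  (fun u : R => c * (B (Num.max 0 u) w + mu * u)) expR); last exact: continuous_expR.
apply: cvgM; first exact: cvg_cst.
apply: cvgD; first exact: (continuous_max0 (cB w)).
by apply: cvgM; [exact: cvg_cst|exact: cvg_id].
Qed.

Lemma walk_last n w : walk B mu (t / n.+1%:R) n.+1 w = B t w + mu * t.
Proof. by rewrite /walk mulrC divfK. Qed.

Let cvg_walk_sum c w :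
  (dn n * \sum_(k < n.+1) expR (c * walk B mu (dn n) k w)) @[n --> \oo]
  --> Rintegral leb `[0, t] (bm c w).
Proof.
have := cvg_riemann_sum (@continuous_bm c w) t_gt0.
apply: cvg_trans; apply: near_eq_cvg; apply: nearW => n.
congr (_ * _); apply: eq_bigr => k _.
by rewrite /bm /walk max_r// mulr_ge0//; exact/ltW/dn_gt0.
Qed.

Lemma expBM_functionalE w :
  expBM_functional B mu t w = Rintegral leb `[0, t] (bm 2 w).
Proof.
apply: eq_Rintegral => u; rewrite inE/= in_itv/= => /andP[u0 _].
by rewrite /bm max_r.
Qed.

Lemma cvg_walkA w :
  walkA B mu (t / n.+1%:R) n.+1 w @[n --> \oo] --> expBM_functional B mu t w.
Proof. by rewrite expBM_functionalE; exact: cvg_walk_sum. Qed.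

Lemma expBM_functional_gt0 w : 0 < expBM_functional B mu t w.
Proof.
rewrite expBM_functionalE.
have cs : {within `[0, t], continuous (bm 2 w)} by exact: continuous_subspaceT.
have [c _ hc] := EVT_min (ltW t_gt0) cs.
have Icst : Rintegral leb `[0, t] (fun=> bm 2 w c) = bm 2 w c * t.
  by rewrite Rintegral_cst//= lebesgue_measure_itv/= lte_fin t_gt0 -EFinB/= subr0.
apply: (@lt_le_trans _ _ (bm 2 w c * t)); first by rewrite mulr_gt0// expR_gt0.
rewrite -Icst; apply: le_Rintegral => //.
- apply: continuous_compact_integrable; first exact: segment_compact.
  by apply: continuous_subspaceT => x; exact: cvg_cst.
- by apply: continuous_compact_integrable => //; exact: segment_compact.
Qed.

Lemma measurable_expBM : measurable_fun setT (expBM_functional B mu t).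
Proof.
apply: (measurable_fun_cvg (h := fun n => walkA B mu (t / n.+1%:R) n.+1)).
- by move=> n; exact: (measurable_walkA hB mu (dn_gt0 n)).
- by move=> w _; exact: cvg_walkA.
Qed.

Lemma bounded_integrable (f : T -> R) (M : R) : measurable_fun setT f ->
  (forall w, `|f w| <= M) -> P.-integrable setT (EFin \o f).
Proof.
move=> mf fM; apply: measurable_bounded_integrable => //.
  exact: (le_lt_trans (probability_le1 P measurableT) (ltry _)).
exists M; split; first exact: num_real.
by move=> x Mx w _ /=; rewrite (le_trans (fM w))// ltW.
Qed.

Variables (Phi Phi1 Phi2 : R -> R -> R) (C L : R).
Hypothesis mPhi : measurable_fun setT (fun p : R * R => Phi p.1 p.2).
Hypothesis Phi_ge0 : forall b a, 0 <= Phi b a.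
Hypothesis dPhi : forall (u v : R -> R) (s du dv : R),
  is_derive s 1 u du -> is_derive s 1 v dv -> 0 < v s ->
  is_derive s 1 (fun x => Phi (u x) (v x))
    (Phi1 (u s) (v s) * du + Phi2 (u s) (v s) * dv).
Hypothesis bPhi : forall b a, 0 < a ->
  [/\ `|Phi b a| <= C, `|Phi1 b a| <= C & `|Phi2 b a| <= C].
Hypothesis sPhi : forall b a, L < a ->
  [/\ Phi b a = 0, Phi1 b a = 0 & Phi2 b a = 0].
Hypothesis sPhib : forall b a, L < b -> Phi b a = 0.
Hypothesis cPhi : forall b a : R, 0 < a ->
  [/\ (fun p : R * R => Phi p.1 p.2) p @[p --> (b, a)] --> Phi b a,
      (fun p : R * R => Phi1 p.1 p.2) p @[p --> (b, a)] --> Phi1 b a &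
      (fun p : R * R => Phi2 p.1 p.2) p @[p --> (b, a)] --> Phi2 b a].

(** The rate in the constant factor of [walk_shift]: 2 from the Gaussian square and 2 mu from the
    drift over one step. *)
Let c : R := 2 * (1 + mu).

Let C_ge0 : 0 <= C.
Proof. by have [h _ _] := bPhi 0 (@ltr01 R); exact: le_trans h. Qed.

Section fixed_step.
Variables (s : R) (n : nat).
Hypothesis s_gt0 : 0 < s.
Let b := walk B mu s.
Let A := walkA B mu s.
Let X k w := expR (2 * b k.+1 w) * Phi (b n w) (A n w).
Let Y k w := expR (c * s) * (expR (2 * b k w)
  * Phi (b n w + 2 * s) (A k.+1 w + expR (4 * s) * (A n w - A k.+1 w))).

Let AS_gt0 k w : 0 < A k.+1 w.
Proof.
rewrite /A walkAS ltr_wpDl ?mulr_gt0 ?expR_gt0//.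
by rewrite mulr_ge0 ?(ltW s_gt0)// sumr_ge0// => i _; rewrite expR_ge0.
Qed.

Let A_le k m w : (k <= m)%N -> A k w <= A m w.
Proof.
move=> km; rewrite -(subnKC km) /A /walkA big_split_ord/= ler_wpM2l ?(ltW s_gt0)//.
by rewrite lerDl sumr_ge0// => i _; rewrite expR_ge0.
Qed.

Let expA k w : (k < n)%N -> expR (2 * b k w) <= A n w / s.
Proof.
move=> kn; rewrite ler_pdivlMr// mulrC (le_trans _ (A_le w kn))// /A walkAS.
by rewrite lerDr mulr_ge0 ?(ltW s_gt0)// sumr_ge0// => i _; rewrite expR_ge0.
Qed.

Let mX k : measurable_fun setT (X k).
Proof.
apply: measurable_funM.
  by apply: measurableT_comp => //; apply: measurable_funM => //; exact: (measurable_walk hB mu s_gt0).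
apply: (measurableT_comp mPhi (g := fun w => (b n w, A n w))).
by apply/measurable_fun_pair; [exact: (measurable_walk hB mu s_gt0)|exact: (measurable_walkA hB mu s_gt0)].
Qed.

Let mY k : measurable_fun setT (Y k).
Proof.
apply: measurable_funM => //; apply: measurable_funM.
  by apply: measurableT_comp => //; apply: measurable_funM => //; exact: (measurable_walk hB mu s_gt0).
apply: (measurableT_comp mPhi (g := fun w => (b n w + 2 * s,
  A k.+1 w + expR (4 * s) * (A n w - A k.+1 w)))).
apply/measurable_fun_pair => /=.
  by apply: measurable_funD => //; exact: (measurable_walk hB mu s_gt0).
apply: measurable_funD; first exact: (measurable_walkA hB mu s_gt0).
apply: measurable_funM => //.
by apply: measurable_funB; exact: (measurable_walkA hB mu s_gt0).
Qed.

(** The bound explodes as the step [s] shrinks; it serves only integrability on a fixed grid. *)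
Let bX k w : (k < n)%N -> `|X k w| <= (`|L| / s + expR (2 * `|L|)) * C.
Proof.
move=> kn; have A0 : 0 < A n w by rewrite (lt_le_trans (AS_gt0 k w))// A_le.
have RHS0 : 0 <= (`|L| / s + expR (2 * `|L|)) * C.
  by rewrite mulr_ge0// addr_ge0 ?expR_ge0// divr_ge0// ltW.
rewrite /X; have [LA|AL] := ltP L (A n w).
  by have [-> _ _] := sPhi (b n w) LA; rewrite mulr0 normr0.
have [Lb|bL] := ltP L (b n w).
  by rewrite (sPhib _ Lb) mulr0 normr0.
have [h _ _] := bPhi (b n w) A0.
rewrite normrM ler_pM// ger0_norm ?expR_ge0//.
(* For k.+1 = n the exponential is not one of the summands of [A n], so it is controlled by the
   vanishing of [Phi] for large b instead. *)
move: kn; rewrite leq_eqVlt => /predU1P[kn|kn].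
  rewrite kn ler_wpDl ?divr_ge0 ?(ltW s_gt0)// ler_expR ler_wpM2l//.
  by rewrite (le_trans bL)// ler_norm.
rewrite ler_wpDr ?expR_ge0// (le_trans (expA w kn))// ler_wpM2r ?invr_ge0 ?(ltW s_gt0)//.
by rewrite (le_trans AL)// ler_norm.
Qed.

Let bY k w : (k < n)%N -> `|Y k w| <= expR (c * s) * (`|L| / s * C).
Proof.
move=> kn.
have RHS0 : 0 <= expR (c * s) * (`|L| / s * C).
  by rewrite mulr_ge0 ?expR_ge0// mulr_ge0// divr_ge0// ltW.
rewrite /Y; set a := A k.+1 w + _.
have e1 : 1 <= expR (4 * s) by rewrite -expR0 ler_expR mulr_ge0// ltW.
have Aa : A n w <= a.
  by have := A_le w kn; rewrite /a; nra.
have a0 : 0 < a.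
  by rewrite (lt_le_trans _ Aa)// (lt_le_trans (AS_gt0 k w))// A_le.
have [LA|AL] := ltP L a.
  by have [-> _ _] := sPhi (b n w + 2 * s) LA; rewrite !mulr0 normr0.
have [h _ _] := bPhi (b n w + 2 * s) a0.
rewrite !normrM !(ger0_norm (expR_ge0 _)) ler_wpM2l ?expR_ge0// ler_pM ?expR_ge0//.
rewrite (le_trans (expA w kn))// ler_wpM2r ?invr_ge0 ?(ltW s_gt0)//.
by rewrite (le_trans Aa)// (le_trans AL)// ler_norm.
Qed.

Lemma integral_walk_diff :
  (\int[P]_w (\sum_(k < n) (X k w - Y k w))%:E = 0)%E.
Proof.
have iX (k : 'I_n) : P.-integrable setT (EFin \o X k).
  by apply: bounded_integrable => // w; exact: bX.
have iY (k : 'I_n) : P.-integrable setT (EFin \o Y k).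
  by apply: bounded_integrable => // w; exact: bY.
under eq_integral do rewrite -sumEFin.
rewrite integral_sum//; last first.
  move=> k; rewrite [X in integrable _ _ X](_ : _ = ((EFin \o X k) \- (EFin \o Y k))%E).
    exact: integrableB.
  by apply/funext => w /=; rewrite EFinB.
rewrite big1// => k _.
under eq_integral do rewrite EFinB.
rewrite integralB_EFin//.
have -> : (\int[P]_w (X k w)%:E = \int[P]_w (Y k w)%:E)%E.
  rewrite /X (walk_shift hB mu s_gt0 (ltn_ord k) mPhi Phi_ge0) -ge0_integralZl//.
  - have : measurable_fun setT (fun w => (expR (c * s))^-1 * Y k w).
      exact: measurable_funM.
    move/measurable_EFinP; apply: eq_measurable_fun => w _ /=.
    by rewrite /Y mulKf// gt_eqF// expR_gt0.
  - by move=> w _; rewrite lee_fin mulr_ge0// expR_ge0.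
by rewrite subee//; exact: (integrable_fin_num measurableT (iY k)).
Qed.

(** In [X] the function [Phi] is evaluated at the end of the walk for every k, so the differences of
    [expR (2 * b k w)] telescope: this is the origin of the factor e^(2Y) - 1. *)
Lemma walk_diffE w : \sum_(k < n) (X k w - Y k w)
  = (expR (2 * b n w) - 1) * Phi (b n w) (A n w)
    - s^-1 * flow_sum Phi c (fun k => s * expR (2 * b k w)) s n (b n w).
Proof.
have aE k : \sum_(j < k) s * expR (2 * b j w) = A k w.
  by rewrite -mulr_sumr.
have b0 : b 0%N w = 0 by rewrite /b (walk_sum hB) big_ord0 !(mul0r, mulr0, addr0).
have -> : expR (2 * b n w) - 1 = \sum_(k < n) (expR (2 * b k.+1 w) - expR (2 * b k w)).
  rewrite -(big_mkord xpredT (fun k => expR (2 * b k.+1 w) - expR (2 * b k w))).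
  by rewrite telescope_sumr// b0 mulr0 expR0.
rewrite mulr_suml /flow_sum mulr_sumr -sumrB; apply: eq_bigr => k _.
rewrite !aE /X /Y !mulrA mulVf ?gt_eqF// mul1r.
by ring.
Qed.

End fixed_step.

Lemma cvg_flow_sum w :
  let b := B t w + mu * t in let a := expBM_functional B mu t w in
  (dn n)^-1 * flow_sum Phi c (fun k => dn n * expR (2 * walk B mu (dn n) k w))
     (dn n) n.+1 b @[n --> \oo]
  --> a * (c * Phi b a + 2 * Phi1 b a) + a ^+ 2 / 2 * (4 * Phi2 b a).
Proof.
move=> b a.
have a0 : 0 < a := expBM_functional_gt0 w.
have [c0 c1 c2] := cPhi b a0.
have s1 : (fun p : R * R => b + 2 * p.1) p @[p --> (0, a)] --> b.
  rewrite -[X in _ --> X]addr0 -[X in _ --> b + X](mulr0 2).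
  apply: cvgD; first exact: cvg_cst.
  by apply: cvgM; [exact: cvg_cst|exact: cvg_fst].
have s2 : (fun p : R * R => p.2) p @[p --> (0, a)] --> a by exact: cvg_snd.
have ek (k : R) : (fun p : R * R => expR (k * p.1)) p @[p --> (0, a)] --> (1 : R).
  rewrite -[X in _ --> X]expR0 -[X in _ --> expR X](mulr0 k).
  apply: (@cvg_comp _ _ _ (fun p : R * R => k * p.1) expR); last exact: continuous_expR.
  by apply: cvgM; [exact: cvg_cst|exact: cvg_fst].
have FF : Filter (nbhs ((0 : R), a)) by exact: nbhs_filter.
have p0 : (fun p : R * R => Phi (b + 2 * p.1) p.2) p @[p --> (0, a)] --> Phi b a.
  exact: (@continuous2_cvg _ R R R _ FF _ _ Phi b a c0 s1 s2).
have p1 : (fun p : R * R => Phi1 (b + 2 * p.1) p.2) p @[p --> (0, a)] --> Phi1 b a.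
  exact: (@continuous2_cvg _ R R R _ FF _ _ Phi1 b a c1 s1 s2).
have p2 : (fun p : R * R => Phi2 (b + 2 * p.1) p.2) p @[p --> (0, a)] --> Phi2 b a.
  exact: (@continuous2_cvg _ R R R _ FF _ _ Phi2 b a c2 s1 s2).
have cU : flowU Phi Phi1 c b p @[p --> (0, a)] --> flowU Phi Phi1 c b (0, a).
  rewrite [X in _ --> X]/flowU/= !mulr0 addr0 expR0.
  apply: cvgM; first exact: ek.
  apply: cvgD; apply: cvgM; try exact: cvg_cst.
    exact: p0.
  exact: p1.
have cV : flowV Phi2 c b p @[p --> (0, a)] --> flowV Phi2 c b (0, a).
  rewrite [X in _ --> X]/flowV/= !mulr0 addr0 expR0.
  apply: cvgM.
    apply: cvgM; last exact: ek.
    by apply: cvgM; [exact: cvg_cst|exact: ek].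
  exact: p2.
set U := flowU Phi Phi1 c b (0, a) in cU; set V := flowV Phi2 c b (0, a) in cV.
have -> : a * (c * Phi b a + 2 * Phi1 b a) + a ^+ 2 / 2 * (4 * Phi2 b a)
  = a * U + (a ^+ 2 - 0) / 2 * V.
  by rewrite /U /V /flowU /flowV/= !mulr0 addr0 expR0 subr0; ring.
pose an n := walkA B mu (dn n) n.+1 w.
have can : an n @[n --> \oo] --> a by exact: cvg_walkA.
(* The diagonal left over by [cross]. It is the step times a Riemann sum of exp(4 (B_u + mu u)),
   hence negligible. *)
pose q n := \sum_(k < n.+1) (dn n * expR (2 * walk B mu (dn n) k w)) ^+ 2.
have cq : q n @[n --> \oo] --> (0 : R).
  have -> : q = (fun n => dn n * (dn n * \sum_(k < n.+1) expR (4 * walk B mu (dn n) k w))).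
    apply/funext => n; rewrite /q mulrA -expr2 mulr_sumr; apply: eq_bigr => k _.
    rewrite exprMn; congr (_ * _); rewrite expr2 -expRD; congr expR; ring.
  rewrite -[X in _ --> X](mul0r (Rintegral leb `[0, t] (bm 4 w))).
  by apply: cvgM; [exact: cvg_dn|exact: cvg_walk_sum].
have cmain : an n * U + (an n ^+ 2 - q n) / 2 * V @[n --> \oo]
    --> a * U + (a ^+ 2 - 0) / 2 * V.
  apply: cvgD; first by apply: cvgM => //; exact: cvg_cst.
  apply: cvgM; last exact: cvg_cst.
  apply: cvgM; last exact: cvg_cst.
  apply: cvgB => //.
  by rewrite expr2; under eq_fun do rewrite expr2; exact: cvgM.
set f := (X in X @ _ --> _).
have -> : f = (fun n => (f n - (an n * U + (an n ^+ 2 - q n) / 2 * V))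
                    + (an n * U + (an n ^+ 2 - q n) / 2 * V)).
  by apply/funext => n; rewrite subrK.
rewrite -[X in _ --> X]add0r; apply: cvgD => //.
apply/cvgrPdist_le => eps eps0.
(* Dominates [an n * (1 + an n)] as soon as [an n] is within 1 of [a]. *)
pose K := (a + 1) * (1 + (a + 1)).
have K0 : 0 < K by rewrite mulr_gt0// ?addr_gt0.
have eK : 0 < eps / K by rewrite divr_gt0.
have : \forall p \near ((0 : R), a), `|flowU Phi Phi1 c b p - U| <= eps / K
    /\ `|flowV Phi2 c b p - V| <= eps / K.
  near=> p; split; rewrite distrC; near: p.
    by move/cvgrPdist_le : cU; exact.
  by move/cvgrPdist_le : cV; exact.
move=> /nbhs_ballP[eta /= eta0 Heta].
have c4 : expR (4 * dn n) * an n @[n --> \oo] --> a.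
  rewrite -[X in _ --> X]mul1r; apply: cvgM => //.
  rewrite -[X in _ --> X]expR0 -[X in _ --> expR X](mulr0 4).
  apply: (@cvg_comp _ _ _ (fun n => 4 * dn n) expR); last exact: continuous_expR.
  by apply: cvgM; [exact: cvg_cst|exact: cvg_dn].
have eta2 : 0 < eta / 2 by rewrite divr_gt0.
near=> n; rewrite sub0r normrN.
have h1 : `|dn n| <= eta / 2.
  by near: n; move/cvgr0_norm_le : cvg_dn; exact.
have h2 : `|an n - a| <= eta / 2.
  by rewrite distrC; near: n; move/cvgrPdist_le : can; exact.
have h3 : `|expR (4 * dn n) * an n - a| <= eta / 2.
  by rewrite distrC; near: n; move/cvgrPdist_le : c4; exact.
have h4 : `|an n - a| <= 1.
  by rewrite distrC; near: n; move/cvgrPdist_le : can; apply.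
have e0 k : 0 < dn n * expR (2 * walk B mu (dn n) k w).
  by rewrite mulr_gt0// expR_gt0.
have aE : \sum_(j < n.+1) dn n * expR (2 * walk B mu (dn n) j w) = an n.
  by rewrite -mulr_sumr.
have := @flow_sum_dist R Phi Phi1 Phi2 c dPhi _ (dn n) n.+1 e0 (dn_gt0 n)
  b a (eps / K) (eta / 2) (ltW eK).
rewrite aE => /(_ (le_trans (ler_norm _) h1) h2 h3).
have UV : forall z x : R, `|z| <= eta / 2 -> `|x - a| <= eta / 2 ->
    `|flowU Phi Phi1 c b (z, x) - U| <= eps / K /\
    `|flowV Phi2 c b (z, x) - V| <= eps / K.
  move=> z x hz hx; apply: Heta; split; rewrite /ball/=.
    by rewrite sub0r normrN (le_lt_trans hz)// ltr_pdivrMr// ltr_pMr// ltr1n.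
  by rewrite distrC (le_lt_trans hx)// ltr_pdivrMr// ltr_pMr// ltr1n.
move=> /(_ UV) H.
rewrite /f -[X in _ - X](mulKf (x := dn n)) ?gt_eqF// -mulrBr normrM.
rewrite gtr0_norm ?invr_gt0// ler_pdivrMl// (le_trans H)//.
rewrite ler_wpM2l ?(ltW (dn_gt0 n))//.
have an0 : 0 <= an n.
  by rewrite mulr_ge0 ?(ltW (dn_gt0 n))// sumr_ge0// => i _; rewrite expR_ge0.
have an1 : an n <= a + 1 by move: h4; rewrite ler_norml; lra.
rewrite mulrCA (@le_trans _ _ (eps / K * K))//; last by rewrite divfK ?gt_eqF.
rewrite ler_wpM2l ?(ltW eK)// ler_pM//; last by rewrite lerD2l.
by rewrite addr_ge0.
Unshelve. all: by end_near. Qed.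

(** Dominated convergence along the grids: the discrete expression has expectation exactly 0 on each
    of them. *)
Lemma stein_identity :
  (\int[P]_w (let b := B t w + mu * t in let a := expBM_functional B mu t w in
     (expR (2 * b) - 1) * Phi b a
     - (a * (c * Phi b a + 2 * Phi1 b a) + a ^+ 2 / 2 * (4 * Phi2 b a)))%:E = 0)%E.
Proof.
pose f_ n w := \sum_(k < n.+1)
  (expR (2 * walk B mu (dn n) k.+1 w)
     * Phi (walk B mu (dn n) n.+1 w) (walkA B mu (dn n) n.+1 w)
   - expR (c * dn n) * (expR (2 * walk B mu (dn n) k w)
     * Phi (walk B mu (dn n) n.+1 w + 2 * dn n)
      (walkA B mu (dn n) k.+1 w + expR (4 * dn n)
        * (walkA B mu (dn n) n.+1 w - walkA B mu (dn n) k.+1 w)))).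
set f := (X in (\int[P]_w (X w)%:E)%E).
have fE n w : f_ n w = (expR (2 * (B t w + mu * t)) - 1)
     * Phi (B t w + mu * t) (walkA B mu (dn n) n.+1 w)
   - (dn n)^-1 * flow_sum Phi c (fun k => dn n * expR (2 * walk B mu (dn n) k w))
     (dn n) n.+1 (B t w + mu * t).
  by rewrite /f_ walk_diffE// walk_last.
have mf n : measurable_fun setT (f_ n).
  apply: measurable_sum => k.
  have mw j := measurable_walk hB mu (dn_gt0 n) j.
  have mA j := measurable_walkA hB mu (dn_gt0 n) j.
  apply: measurable_funB.
    apply: measurable_funM.
      by apply: measurableT_comp => //; exact: measurable_funM.
    apply: (measurableT_comp mPhi (g := fun w =>
      (walk B mu (dn n) n.+1 w, walkA B mu (dn n) n.+1 w))).
    exact/measurable_fun_pair.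
  apply: measurable_funM => //; apply: measurable_funM.
    by apply: measurableT_comp => //; exact: measurable_funM.
  apply: (measurableT_comp mPhi (g := fun w =>
    (walk B mu (dn n) n.+1 w + 2 * dn n, walkA B mu (dn n) k.+1 w
      + expR (4 * dn n) * (walkA B mu (dn n) n.+1 w - walkA B mu (dn n) k.+1 w)))).
  apply/measurable_fun_pair => /=; first exact: measurable_funD.
  apply: measurable_funD => //; apply: measurable_funM => //.
  exact: measurable_funB.
have ff w : f_ n w @[n --> \oo] --> f w.
  under eq_fun do rewrite fE.
  apply: cvgB; last exact: cvg_flow_sum.
  apply: cvgM; first exact: cvg_cst.
  have [c0 _ _] := cPhi (B t w + mu * t) (expBM_functional_gt0 w).
  by apply: (@continuous2_cvg _ R R R _ _ (fun=> B t w + mu * t)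
    (fun n => walkA B mu (dn n) n.+1 w) Phi _ _ c0); [exact: cvg_cst|exact: cvg_walkA].
(* The first summand bounds the telescoped term, which vanishes for b > L; the second is
   [flow_sum_bound] divided by the step. Neither depends on the grid. *)
pose M := (expR (2 * `|L|) + 1) * C
  + `|L| * (expR (`|c| * t) * (`|c| * C + 2 * C)
     + `|L| * (4 * expR (`|c| * t) * expR (4 * t) * C)).
have fM n w : `|f_ n w| <= M.
  have e0 k : 0 < dn n * expR (2 * walk B mu (dn n) k w).
    by rewrite mulr_gt0// expR_gt0.
  rewrite fE (le_trans (ler_normB _ _))// lerD//; last first.
    rewrite normrM gtr0_norm ?invr_gt0// ler_pdivrMl//.
    exact: (@flow_sum_bound R Phi Phi1 Phi2 c C L dPhi bPhi sPhi).
  have A0 : 0 < walkA B mu (dn n) n.+1 w.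
    rewrite mulr_gt0// big_ord_recl/= ltr_pwDl ?expR_gt0//.
    by apply: sumr_ge0 => i _; rewrite expR_ge0.
  have [Lb|bL] := ltP L (B t w + mu * t).
    by rewrite (sPhib _ Lb) mulr0 normr0 mulr_ge0// addr_ge0// expR_ge0.
  have [h _ _] := bPhi (B t w + mu * t) A0.
  rewrite normrM ler_pM// (le_trans (ler_normB _ _))// normr1 lerD2r.
  rewrite ger0_norm ?expR_ge0// ler_expR ler_wpM2l//.
  by rewrite (le_trans bL)// ler_norm.
have mff : measurable_fun setT f.
  by apply: (measurable_fun_cvg mf) => w _; exact: ff.
have [| | | | |_ _] := @dominated_convergence _ _ _ P setT measurableT
  (fun n => EFin \o f_ n) (EFin \o f) (EFin \o cst M).
- by move=> n; exact/measurable_EFinP.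
- exact/measurable_EFinP.
- by apply: aeW => w _ /=; apply: cvg_EFin; [exact: nearW|exact: ff].
- by apply: (@bounded_integrable _ `|M|).
- by apply: aeW => w n _ /=; rewrite lee_fin.
move=> H; apply/esym; move: H.
rewrite [X in X @ _ --> _](_ : _ = (fun=> 0%E)); last first.
  by apply/funext => n /=; exact: integral_walk_diff.
by move/cvg_lim => /= <-//; rewrite lim_cst.
Qed.

End expBM.

(** * Differentiation rules and a C^1 bump *)

Section calculus.
Context (R : realType).
Implicit Types (x y u : R) (f g : R -> R).

Lemma is_derive_expR_comp f x df : is_derive x 1 f df ->
  is_derive x 1 (fun y => expR (f y)) (expR (f x) * df).
Proof. by move=> h; exact: (@is_derive1_comp _ expR f). Qed.

(* The derivative is written with expR (- ln _) instead of an inverse so that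
   the identities between derivatives become polynomial. *)
Lemma is_derive_ln_comp f x df : 0 < f x -> is_derive x 1 f df ->
  is_derive x 1 (fun y => ln (f y)) (expR (- ln (f x)) * df).
Proof.
move=> fx0 h; rewrite expRN lnK//.
exact: (@is_derive1_comp R (@ln R) f x _ _ (is_derive1_ln fx0) h).
Qed.

Lemma is_derive_comp_eq g dg f x df :
  (forall y, is_derive y 1 g (dg y)) -> is_derive x 1 f df ->
  is_derive x 1 (fun y => g (f y)) (dg (f x) * df).
Proof. by move=> hg h; exact: (@is_derive1_comp _ g f). Qed.

Lemma continuous_bounded f (L : R) : continuous f ->
  (forall y, L < `|y| -> f y = 0) -> exists2 C, 0 <= C & forall y, `|f y| <= C.
Proof.
move=> cf f0; pose M := `|L|.
have M0 : 0 <= M by exact: normr_ge0.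
have MM : - M <= M by rewrite (@le_trans _ _ 0)// oppr_le0.
have cn : {within `[- M, M], continuous (fun y => `|f y|)}.
  by apply: continuous_subspaceT => y; apply: cvg_norm; exact: cf.
have [c _ hc] := EVT_max MM cn.
exists `|f c| => // y; have [yM|My] := leP `|y| M.
  by apply: hc; rewrite in_itv/= -ler_norml.
by rewrite f0 ?normr0// (le_lt_trans _ My)// ler_norm.
Qed.

(** Squaring the positive part makes the bump continuously differentiable across the ends of its
    support [-1, 1], which is all the smoothness that the test functions need. *)
Definition bump u : R := Num.max 0 (1 - u ^+ 2) ^+ 2.
Definition dbump u : R := - (4 * u * Num.max 0 (1 - u ^+ 2)).

Lemma is_derive_posX2 x :
  is_derive x 1 (fun y : R => Num.max 0 y ^+ 2) (2 * Num.max 0 x).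
Proof.
have [x0|x0|->] := ltgtP x 0.
- rewrite mulr0; apply: (near_eq_is_derive (f := cst 0)).
    near=> y; rewrite /cst max_l ?expr0n//.
    by apply/ltW; near: y; exact: lt_nbhsl.
- apply: (near_eq_is_derive (f := fun y : R => y * y)).
    near=> y; rewrite max_r ?expr2//.
    by apply/ltW; near: y; exact: lt_nbhsr.
  by apply: is_derive_eq; rewrite /GRing.scale/=; ring.
(* At 0 the difference quotient of the squared positive part is the positive part itself, which is
   continuous and vanishes there. *)
- rewrite mulr0; apply/is_derive1_caratheodory.
  exists (fun y => Num.max 0 y); split => /=.
  + move=> y; rewrite maxxx expr0n/= !subr0.
    by have [y0|y0] := leP 0 y; rewrite expr2 ?mul0r.
  + apply: continuous_max; [exact: cvg_cst|exact: cvg_id].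
  + by rewrite maxxx.
Unshelve. all: by end_near. Qed.

Lemma is_derive_bump u : is_derive u 1 bump (dbump u).
Proof.
have h : is_derive u 1 (fun u : R => 1 - u ^+ 2) (- (2 * u)).
  by apply: is_derive_eq; rewrite /GRing.scale/=; ring.
have -> : dbump u = 2 * Num.max 0 (1 - u ^+ 2) * - (2 * u) by rewrite /dbump; ring.
exact: (is_derive_comp_eq is_derive_posX2 h).
Qed.

Lemma continuous_pos : continuous (fun u : R => Num.max 0 (1 - u ^+ 2)).
Proof.
move=> u; apply: (@continuous_max _ _ (fun=> 0) (fun u : R => 1 - u ^+ 2) u).
  exact: cvg_cst.
by apply: cvgB; [exact: cvg_cst|exact: sqr_continuous].
Qed.

Lemma continuous_bump : continuous bump.
Proof.
move=> u; apply: (@cvg_comp _ _ _ (fun u : R => Num.max 0 (1 - u ^+ 2))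
  (fun u => u ^+ 2)); first exact: continuous_pos.
exact: sqr_continuous.
Qed.

Lemma continuous_dbump : continuous dbump.
Proof.
move=> u; apply: cvgN; apply: cvgM; last exact: continuous_pos.
by apply: cvgM; [exact: cvg_cst|exact: cvg_id].
Qed.

Lemma bump_ge0 u : 0 <= bump u. Proof. exact: sqr_ge0. Qed.

Lemma bump_out u : 1 < `|u| -> bump u = 0 /\ dbump u = 0.
Proof.
move=> u1; have h : 1 - u ^+ 2 <= 0.
  by rewrite subr_le0 -real_normK ?num_real// exprn_ege1// ltW.
by rewrite /bump /dbump max_l// expr0n mulr0 oppr0.
Qed.

(** Makes cutoffs increase as they widen, so that they can be removed by monotone convergence. *)
Lemma bump_antitone (u v : R) : `|v| <= `|u| -> bump u <= bump v.
Proof.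
move=> vu; have m0 (z : R) : 0 <= Num.max 0 z by rewrite le_max lexx.
rewrite /bump lerXn2r ?nnegrE ?m0//.
rewrite ge_max; apply/andP; split; first by rewrite le_max lexx.
rewrite le_max; apply/orP; right.
by rewrite lerD2l lerN2 -[v ^+ 2]real_normK ?num_real//
  -[u ^+ 2]real_normK ?num_real// lerXn2r ?nnegrE.
Qed.

Lemma bump_gt0 u : `|u| < 1 -> 0 < bump u.
Proof.
move=> u1; rewrite /bump exprn_gt0// lt_max ltxx/= subr_gt0.
by rewrite -real_normK ?num_real// expr_lt1.
Qed.

Lemma cvg_bump_scale u : bump (u / n.+1%:R) @[n --> \oo] --> (1 : R).
Proof.
have b0 : bump 0 = 1.
  by rewrite /bump expr0n/= subr0 max_r// expr1n.
rewrite -[X in _ --> X]b0; apply: (continuous_cvg _ (@continuous_bump 0)).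
rewrite -[X in _ --> X](mulr0 u); apply: cvgM; first exact: cvg_cst.
exact: cvg_harmonic.
Qed.

End calculus.

Ltac norm_bound :=
  try assumption;
  lazymatch goal with
  | |- is_true (0 <= _ * _) => apply: mulr_ge0; norm_bound
  | |- is_true (0 <= _) => exact: normr_ge0
  | |- is_true (`|?u| <= `|?u|) => exact: lexx
  | |- is_true (`|- _| <= _) => rewrite normrN; norm_bound
  | |- is_true (`|_ + _| <= _ + _) =>
      apply: (le_trans (ler_normD _ _)); apply: lerD; norm_bound
  | |- is_true (`|_ * _| <= _ * _) => rewrite normrM; apply: ler_pM; norm_bound
  end.

(** * Translation invariance *)

Section translation.
Context (R : realType) (d : measure_display) (T : measurableType d).
Variables (P : probability T R) (B : R -> T -> R).
Hypothesis hB : is_standard_BM P B.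
Variables (mu t : R).
Hypothesis t_gt0 : 0 < t.

(* With y = B_t + mu t and a = A_t, [ratio y a] is e^y / A_t. *)
Definition ratio (y a : R) : R := expR (y - ln a).
Definition iratio (y a : R) : R := expR (ln a - y).

Definition coshx (x y : R) : R := cosh y + x * expR (- y).
Definition dcoshx (x y : R) : R := sinh y - x * expR (- y).

(** As r - 1/r = 2 sinh (ln r), the support keeps r away from both 0 and infinity, and the cutoff
    tends to 1 as N grows. Next, [dcutoff] is its derivative in ln r. *)
Definition cutoff (N y a : R) : R := bump ((ratio y a - iratio y a) / N).
Definition dcutoff (N y a : R) : R :=
  dbump ((ratio y a - iratio y a) / N) * ((ratio y a + iratio y a) / N).

Variables (N x : R) (q dq : R -> R) (L : R).
Hypothesis N_gt0 : 0 < N.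
Hypothesis x_ge0 : 0 <= x.
Hypothesis q_ge0 : forall y, 0 <= q y.
Hypothesis dqE : forall y : R, is_derive y 1 q (dq y).
Hypothesis cdq : continuous dq.
Hypothesis q_out : forall y, L < `|y| -> q y = 0 /\ dq y = 0.

Let cq : continuous q.
Proof.
by move=> y; apply/differentiable_continuous/derivable1_diffP; have [] := dqE y.
Qed.

Definition weight (s y a : R) : R :=
  expR (ratio y a * (cosh y - coshx x (y + s)) - mu * y).

(** This is a times the test function Phi_s; [dTheta] is its derivative in s at fixed y and a. *)
Definition Theta (s y a : R) : R := cutoff N y a * (weight s y a * q (y + s)).

Definition dTheta (s y a : R) : R := cutoff N y a * (weight s y a *
  (dq (y + s) - ratio y a * dcoshx x (y + s) * q (y + s))).

Let Phi s y a := expR (- ln a) * Theta s y a.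

(* Partial derivative of Theta in y at fixed ratio. *)
Let Theta1 s y a := cutoff N y a * (weight s y a *
  ((ratio y a * (sinh y - dcoshx x (y + s)) - mu) * q (y + s) + dq (y + s))).

(* Partial derivative of Theta in the logarithm of the ratio. *)
Let Theta2 s y a := (dcutoff N y a
   + cutoff N y a * (ratio y a * (cosh y - coshx x (y + s))))
  * (weight s y a * q (y + s)).

(** Chain rule with ln r = y - ln a: differentiating in y moves both y and ln r, while
    differentiating in a moves ln r by -1/a and also hits the prefactor 1/a of [Phi]. *)
Let Phi1 s y a := expR (- ln a) * (Theta1 s y a + Theta2 s y a).
Let Phi2 s y a := - (expR (- ln a) ^+ 2 * (Theta s y a + Theta2 s y a)).

Let dPhi s (u v : R -> R) (z du dv : R) :
  is_derive z 1 u du -> is_derive z 1 v dv -> 0 < v z ->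
  is_derive z 1 (fun y => Phi s (u y) (v y))
    (Phi1 s (u z) (v z) * du + Phi2 s (u z) (v z) * dv).
Proof.
move=> hu hv v0.
have hl := is_derive_ln_comp v0 hv.
have hi : is_derive z 1 (fun y => - ln (v y)) (- (expR (- ln (v z)) * dv)).
  exact: is_deriveN.
have hr := is_derive_expR_comp (is_deriveB hu hl).
have hri := is_derive_expR_comp (is_deriveB hl hu).
have hc0 : is_derive z 1 (fun y => (ratio (u y) (v y) - iratio (u y) (v y)) / N)
    ((ratio (u z) (v z) + iratio (u z) (v z)) / N * (du - expR (- ln (v z)) * dv)).
  have h1 : is_derive z 1 (fun y => ratio (u y) (v y)) _ := hr.
  have h2 : is_derive z 1 (fun y => iratio (u y) (v y)) _ := hri.
  apply: is_derive_eq; rewrite /GRing.scale/= -/(ratio (u z) (v z)) -/(iratio (u z) (v z)).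
  by ring.
have hc := is_derive_comp_eq (@is_derive_bump R) hc0.
have hus : is_derive z 1 (fun y => u y + s) du.
  by apply: is_derive_eq; rewrite addr0.
have hq := is_derive_comp_eq dqE hus.
have he (g : R -> R) (dg : R) : is_derive z 1 g dg ->
    is_derive z 1 (fun y => expR (- g y)) (- (expR (- g z) * dg)).
  move=> hg; have hN : is_derive z 1 (fun y => - g y) (- dg) by exact: is_deriveN.
  by rewrite -mulrN; exact: is_derive_expR_comp.
have hk : is_derive z 1 (fun y => cosh (u y) - coshx x (u y + s))
    ((sinh (u z) - dcoshx x (u z + s)) * du).
  have h1 := is_derive_expR_comp hu; have h2 := he _ _ hu.
  have h3 := is_derive_expR_comp hus; have h4 := he _ _ hus.
  rewrite /cosh /coshx /cosh.
  apply: is_derive_eq; rewrite /GRing.scale/= /sinh /dcoshx /sinh.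
  by ring.
have hw : is_derive z 1 (fun y => weight s (u y) (v y))
    (weight s (u z) (v z) *
      (ratio (u z) (v z) * (du - expR (- ln (v z)) * dv)
        * (cosh (u z) - coshx x (u z + s))
       + ratio (u z) (v z) * ((sinh (u z) - dcoshx x (u z + s)) * du) - mu * du)).
  apply: is_derive_expR_comp.
  have h1 : is_derive z 1 (fun y => ratio (u y) (v y))
    (ratio (u z) (v z) * (du - expR (- ln (v z)) * dv)) := hr.
  apply: is_derive_eq; rewrite /GRing.scale/=.
  by ring.
have hcc : is_derive z 1 (fun y => cutoff N (u y) (v y))
    (dcutoff N (u z) (v z) * (du - expR (- ln (v z)) * dv)).
  by apply: is_derive_eq hc _; rewrite /dcutoff mulrA.
have hE := is_derive_expR_comp hi.
rewrite /Phi /Theta; apply: is_derive_eq.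
rewrite /GRing.scale/= /Phi1 /Phi2 /Theta1 /Theta2 /Theta.
by ring.
Qed.

Section bounds.
Variable S : R.
Hypothesis S_ge0 : 0 <= S.

(** Bounds y on the support of [q (y + s)] when [|s| <= S]; [Eb] is the resulting bound on
    [weight]. *)
Let M1 := `|L| + S.
Let Eb := expR ((N + 1) * expR M1 + `|mu| * M1).

Let cosh_le (y m : R) : `|y| <= m -> 0 <= cosh y <= expR m.
Proof.
rewrite ler_norml => /andP[h1 h2]; rewrite /cosh.
have e1 : expR y <= expR m by rewrite ler_expR.
have e2 : expR (- y) <= expR m by rewrite ler_expR lerNl.
have := expR_gt0 y; have := expR_gt0 (- y); lra.
Qed.

Let sinh_le (y m : R) : `|y| <= m -> `|sinh y| <= expR m.
Proof.
rewrite ler_norml => /andP[h1 h2]; rewrite /sinh ler_norml.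
have e1 : expR y <= expR m by rewrite ler_expR.
have e2 : expR (- y) <= expR m by rewrite ler_expR lerNl.
have := expR_gt0 y; have := expR_gt0 (- y); lra.
Qed.

(** Of r and 1/r one is at most 1, and the two differ by at most N. *)
Let ratio_le y a : `|(ratio y a - iratio y a) / N| <= 1 ->
  ratio y a <= N + 1 /\ iratio y a <= N + 1.
Proof.
rewrite normrM (gtr0_norm (_ : 0 < N^-1)) ?invr_gt0// ler_pdivrMr// mul1r.
have ri : ratio y a * iratio y a = 1.
  by rewrite /ratio /iratio -expRD addrC subrKA subrr expR0.
have r0 : 0 < ratio y a := expR_gt0 _.
have i0 : 0 < iratio y a := expR_gt0 _.
rewrite ler_norml => /andP[h1 h2].
by split; [have [|] := leP (iratio y a) 1|have [|] := leP (ratio y a) 1];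
  have := N_gt0; nra.
Qed.

(** Either y, r and 1/r are all confined, or one of the factors [cutoff] and [q] vanishes together
    with its derivative and kills every function considered here. *)
Let regionP s y a : `|s| <= S ->
  [/\ `|y| <= M1, `|y + s| <= `|L|, ratio y a <= N + 1 & iratio y a <= N + 1]
  \/ (cutoff N y a = 0 /\ dcutoff N y a = 0) \/ (q (y + s) = 0 /\ dq (y + s) = 0).
Proof.
move=> sS; have [Ly|yL] := ltP `|L| `|y + s|.
  by right; right; apply: q_out; rewrite (le_lt_trans _ Ly)// ler_norm.
have [h|h] := ltP 1 `|(ratio y a - iratio y a) / N|.
  right; left; rewrite /cutoff /dcutoff.
  by have [-> ->] := bump_out h; rewrite mul0r.
left; have [h1 h2] := ratio_le h; split => //.
have -> : y = (y + s) - s by rewrite addrK.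
by rewrite (le_trans (ler_normB _ _))// lerD.
Qed.

(** Since [coshx] is nonnegative, dropping it from the exponent only increases the weight, and r
    cosh y is bounded on the region. *)
Let weight_le s y a : `|y| <= M1 -> ratio y a <= N + 1 ->
  0 <= weight s y a <= Eb.
Proof.
move=> yM rN; rewrite expR_ge0/= ler_expR lerD//.
  have /andP[c0 c1] := cosh_le yM.
  have /andP[c2 _] := cosh_le (lexx `|y + s|).
  have k0 : 0 <= coshx x (y + s) by rewrite addr_ge0// mulr_ge0// expR_ge0.
  have r0 : 0 < ratio y a := expR_gt0 _.
  apply: (@le_trans _ _ (ratio y a * cosh y)).
    by rewrite ler_pM2l// gerBl.
  by rewrite ler_pM// ltW.
by rewrite -mulNr (le_trans (ler_norm _))// normrM normrN ler_wpM2l.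
Qed.

Let dcoshx_le (z : R) : `|z| <= `|L| -> `|dcoshx x z| <= (1 + x) * expR `|L|.
Proof.
move=> zL; rewrite mulrDl mul1r (le_trans (ler_normB _ _))// lerD//.
  exact: sinh_le.
rewrite normrM ger0_norm// ger0_norm ?expR_ge0// ler_wpM2l// ler_expR.
by rewrite (le_trans _ zL)// ler_normr lexx orbT.
Qed.

Let bump_le1 (u : R) : `|bump u| <= 1.
Proof.
rewrite ger0_norm ?bump_ge0//.
have -> : (1 : R) = bump 0 by rewrite /bump expr0n/= subr0 max_r// expr1n.
by apply: bump_antitone; rewrite normr0.
Qed.

(** The constant is uniform in [|s| <= S], not just valid for each s, because the integral of
    [Theta] will be differentiated in s. *)
Lemma Theta_bounds : exists2 C, 0 <= C & forall s y a, `|s| <= S -> 0 < a ->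
  [/\ `|Theta s y a| <= C, `|dTheta s y a| <= C, `|Phi s y a| <= C,
      `|Phi1 s y a| <= C & `|Phi2 s y a| <= C].
Proof.
have [Q Q0 qQ] := continuous_bounded cq (fun y h => (q_out h).1).
have [Q' Q'0 dqQ] := continuous_bounded cdq (fun y h => (q_out h).2).
have [D D0 dD] := continuous_bounded (@continuous_dbump R) (fun u h => (bump_out h).2).
pose r := N + 1.
pose KL := (1 + x) * expR `|L|.
pose Ab := r * expR M1.
(* Each constant repeats the shape of the function that it bounds, factor by factor; the 1 stands
   for the cutoff. [Ab] bounds 1/a. *)
pose C0 := 1 * (Eb * Q).
pose Cs := 1 * (Eb * (Q' + r * KL * Q)).
pose C1 := 1 * (Eb * ((r * (expR M1 + KL) + `|mu|) * Q + Q')).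
pose C2 := (D * ((r + r) / N) + 1 * (r * (expR M1 + KL))) * (Eb * Q).
pose C := C0 + Cs + Ab * C0 + Ab * (C1 + C2) + Ab ^+ 2 * (C0 + C2).
have r0 : 0 <= r by rewrite addr_ge0 ?(ltW N_gt0).
have KL0 : 0 <= KL by rewrite mulr_ge0 ?expR_ge0// addr_ge0.
have E0 : 0 <= Eb by exact: expR_ge0.
have Ab0 : 0 <= Ab by rewrite mulr_ge0 ?expR_ge0.
have C00 : 0 <= C0 by rewrite !mulr_ge0.
have eM0 : 0 <= expR M1 := expR_ge0 _.
have Ni : 0 <= N^-1 by rewrite invr_ge0 ltW.
have mu0 : 0 <= `|mu| := normr_ge0 _.
have Cs0 : 0 <= Cs by rewrite /Cs; repeat first [assumption|exact: ler01|apply: mulr_ge0|apply: addr_ge0].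
have C10 : 0 <= C1 by rewrite /C1; repeat first [assumption|exact: ler01|apply: mulr_ge0|apply: addr_ge0].
have C20 : 0 <= C2 by rewrite /C2; repeat first [assumption|exact: ler01|apply: mulr_ge0|apply: addr_ge0].
have T1 : 0 <= Ab * C0 by rewrite mulr_ge0.
have T2 : 0 <= Ab * (C1 + C2) by rewrite mulr_ge0// addr_ge0.
have T3 : 0 <= Ab ^+ 2 * (C0 + C2) by rewrite mulr_ge0 ?exprn_ge0// addr_ge0.
have Cge0 : 0 <= C by rewrite /C; lra.
exists C => // s y a sS a0.
have [[yM yL rN iN]|[[h1 h2]|[h1 h2]]] := regionP y a sS; last 2 first.
- by rewrite /Phi /Phi1 /Phi2 /Theta1 /Theta2 /Theta /dTheta h1 h2
    !(mul0r, mulr0, addr0, add0r, oppr0, normr0).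
- by rewrite /Phi /Phi1 /Phi2 /Theta1 /Theta2 /Theta /dTheta h1 h2
    !(mul0r, mulr0, addr0, add0r, oppr0, subr0, normr0).
have rr0 : 0 <= ratio y a := expR_ge0 _.
have ii0 : 0 <= iratio y a := expR_ge0 _.
have /andP[w0 wE] := weight_le s yM rN.
have wE' : `|weight s y a| <= Eb by rewrite ger0_norm.
have rN' : `|ratio y a| <= r by rewrite ger0_norm.
have cb : `|cutoff N y a| <= 1 by exact: bump_le1.
have ckL : `|cosh y - coshx x (y + s)| <= expR M1 + KL.
  have /andP[c0 c1] := cosh_le yM; have /andP[c2 c3] := cosh_le yL.
  have k0 : 0 <= coshx x (y + s) by rewrite addr_ge0// mulr_ge0// expR_ge0.
  rewrite (le_trans (ler_normB _ _))// (ger0_norm c0) (ger0_norm k0) lerD//.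
  rewrite /coshx /KL mulrDl mul1r lerD// ler_wpM2l// ler_expR.
  by rewrite (le_trans _ yL)// ler_normr lexx orbT.
have iN' : `|iratio y a| <= r by rewrite ger0_norm.
have Ni' : `|N^-1| <= N^-1 by rewrite ger0_norm.
have qy := qQ (y + s); have dqy := dqQ (y + s).
have sy := sinh_le yM; have dcy := dcoshx_le yL.
have dby := dD ((ratio y a - iratio y a) / N).
have bT : `|Theta s y a| <= C0 by rewrite /Theta /C0; norm_bound.
have bs : `|dTheta s y a| <= Cs by rewrite /dTheta /Cs; norm_bound.
have bT1 : `|Theta1 s y a| <= C1 by rewrite /Theta1 /C1; norm_bound.
have bT2 : `|Theta2 s y a| <= C2 by rewrite /Theta2 /dcutoff /C2; norm_bound.
have ab : `|expR (- ln a)| <= Ab.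
  rewrite ger0_norm ?expR_ge0//.
  (* 1/a = r e^(-y) is bounded because r and y are. *)
  have -> : expR (- ln a) = ratio y a * expR (- y).
    by rewrite /ratio -expRD; congr expR; ring.
  rewrite ler_pM ?expR_ge0// ler_expR.
  by rewrite (le_trans _ yM)// ler_normr lexx orbT.
have bP : `|Phi s y a| <= Ab * C0 by rewrite normrM ler_pM.
have bP1 : `|Phi1 s y a| <= Ab * (C1 + C2).
  by rewrite normrM ler_pM// (le_trans (ler_normD _ _))// lerD.
have bP2 : `|Phi2 s y a| <= Ab ^+ 2 * (C0 + C2).
  rewrite normrN normrM ler_pM//.
    by rewrite normrX lerXn2r ?nnegrE.
  by rewrite (le_trans (ler_normD _ _))// lerD.
by clear -bT bs bP bP1 bP2 C00 Cs0 T1 T2 T3; rewrite /C; split; lra.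
Qed.

(** On the region y is at most [M1], and a = e^y / r is at most e^M1 (N + 1): a cutoff in r and a
    compactly supported [q] together bound a. *)
Lemma Theta_support : exists LL, forall s y a, `|s| <= S ->
  (LL < a -> [/\ Phi s y a = 0, Phi1 s y a = 0 & Phi2 s y a = 0]) /\
  (LL < y -> Phi s y a = 0).
Proof.
exists (Num.max M1 (expR M1 * (N + 1))) => s y a sS.
have [[yM yL rN iN]|[[h1 h2]|[h1 h2]]] := regionP y a sS; last 2 first.
- by rewrite /Phi /Phi1 /Phi2 /Theta1 /Theta2 /Theta h1 h2
    !(mul0r, mulr0, addr0, add0r, oppr0).
- by rewrite /Phi /Phi1 /Phi2 /Theta1 /Theta2 /Theta h1 h2
    !(mul0r, mulr0, addr0, add0r, oppr0).
split; rewrite gt_max => /andP[h1 h2].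
  exfalso; move: h2; rewrite ltNge => /negP; apply.
  have a0 : 0 < a.
    by rewrite (le_lt_trans _ h1)// addr_ge0.
  have -> : a = expR y * iratio y a.
    by rewrite /iratio -expRD addrC subrK lnK.
  by rewrite ler_pM ?expR_ge0// ler_expR (le_trans _ yM)// ler_norm.
by have := le_trans (ler_norm y) yM; rewrite leNgt h1.
Qed.

End bounds.

Let mcomp (g : R -> R) (f : R * R -> R) : continuous g ->
  measurable_fun setT f -> measurable_fun setT (fun p => g (f p)).
Proof.
by move=> cg mf; apply: measurableT_comp => //; exact: continuous_measurable_fun.
Qed.

Let mln : measurable_fun setT (fun p : R * R => ln p.2).
Proof. exact: (measurableT_comp (@measurable_ln R) measurable_snd). Qed.

Let mratio : measurable_fun setT (fun p : R * R => ratio p.1 p.2).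
Proof. by apply: measurableT_comp => //; apply: measurable_funB. Qed.

Let miratio : measurable_fun setT (fun p : R * R => iratio p.1 p.2).
Proof. by apply: measurableT_comp => //; apply: measurable_funB. Qed.

Let mexp1 (f : R * R -> R) : measurable_fun setT f ->
  measurable_fun setT (fun p => expR (f p)).
Proof. by move=> mf; exact: measurableT_comp. Qed.

Let mcosh (f : R * R -> R) : measurable_fun setT f ->
  measurable_fun setT (fun p => cosh (f p)).
Proof.
move=> mf; apply: measurable_funM => //; apply: measurable_funD; apply: mexp1 => //.
exact: measurable_funN.
Qed.

Let mcutoff : measurable_fun setT (fun p : R * R => cutoff N p.1 p.2).
Proof.
apply: (mcomp (@continuous_bump R)); apply: measurable_funM => //.
exact: measurable_funB.
Qed.

Let mweight s : measurable_fun setT (fun p : R * R => weight s p.1 p.2).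
Proof.
have ms : measurable_fun setT (fun p : R * R => p.1 + s) by exact: measurable_funD.
apply: mexp1; apply: measurable_funB; last exact: measurable_funM.
apply: measurable_funM => //; apply: measurable_funB; first exact: mcosh.
apply: measurable_funD; first exact: mcosh.
by apply: measurable_funM => //; apply: mexp1; exact: measurable_funN.
Qed.

Lemma measurable_dTheta s : measurable_fun setT (fun p : R * R => dTheta s p.1 p.2).
Proof.
have ms : measurable_fun setT (fun p : R * R => p.1 + s) by exact: measurable_funD.
apply: measurable_funM => //; apply: measurable_funM => //.
apply: measurable_funB; first exact: mcomp.
apply: measurable_funM; last exact: mcomp.
apply: measurable_funM => //; apply: measurable_funB.
  apply: measurable_funM => //; apply: measurable_funB; apply: mexp1 => //.
  exact: measurable_funN.
by apply: measurable_funM => //; apply: mexp1; exact: measurable_funN.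
Qed.

Lemma measurable_Theta s : measurable_fun setT (fun p : R * R => Theta s p.1 p.2).
Proof.
have ms : measurable_fun setT (fun p : R * R => p.1 + s) by exact: measurable_funD.
apply: measurable_funM => //; apply: measurable_funM; last exact: mcomp.
exact: mweight.
Qed.

Lemma measurable_Phi s : measurable_fun setT (fun p : R * R => Phi s p.1 p.2).
Proof.
apply: measurable_funM; last exact: measurable_Theta.
by apply: mexp1; exact: measurable_funN.
Qed.

Section continuity.
Variables (b a s : R).
Hypothesis a_gt0 : 0 < a.
Let F : set_system (R * R) := nbhs (b, a).
Let FF : Filter F. Proof. exact: nbhs_filter. Qed.

Let c1 : p.1 @[p --> F] --> b. Proof. exact: cvg_fst. Qed.
Let c2 : ln p.2 @[p --> F] --> ln a.
Proof.
apply: (@cvg_comp _ _ _ (fun p : R * R => p.2) (@ln R) F (nbhs a)).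
  exact: cvg_snd.
exact: continuous_ln.
Qed.

Let ccomp (g : R -> R) (f : R * R -> R) (l : R) : continuous g ->
  f p @[p --> F] --> l -> g (f p) @[p --> F] --> g l.
Proof. by move=> cg cf; apply: (@cvg_comp _ _ _ f g F (nbhs l)); [exact: cf|exact: cg]. Qed.

Let cexp (f : R * R -> R) (l : R) :
  f p @[p --> F] --> l -> expR (f p) @[p --> F] --> expR l.
Proof. exact: (ccomp (@continuous_expR R)). Qed.

Let cs : p.1 + s @[p --> F] --> b + s.
Proof. by apply: cvgD => //; exact: cvg_cst. Qed.

Let ccosh (f : R * R -> R) l : f p @[p --> F] --> l ->
  cosh (f p) @[p --> F] --> cosh l.
Proof.
move=> cf; apply: cvgM; last exact: cvg_cst.
by apply: cvgD; apply: cexp => //; exact: cvgN.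
Qed.

Let csinh (f : R * R -> R) l : f p @[p --> F] --> l ->
  sinh (f p) @[p --> F] --> sinh l.
Proof.
move=> cf; apply: cvgM; last exact: cvg_cst.
by apply: cvgB; apply: cexp => //; exact: cvgN.
Qed.

Let cxe : x * expR (- (p.1 + s)) @[p --> F] --> x * expR (- (b + s)).
Proof. by apply: cvgM; [exact: cvg_cst|apply: cexp; exact: cvgN]. Qed.

Let ccoshx : coshx x (p.1 + s) @[p --> F] --> coshx x (b + s).
Proof. by apply: cvgD => //; exact: ccosh. Qed.

Let cdcoshx : dcoshx x (p.1 + s) @[p --> F] --> dcoshx x (b + s).
Proof. by apply: cvgB => //; exact: csinh. Qed.

Let cratio : ratio p.1 p.2 @[p --> F] --> ratio b a.
Proof. by apply: cexp; exact: cvgB. Qed.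

Let ciratio : iratio p.1 p.2 @[p --> F] --> iratio b a.
Proof. by apply: cexp; exact: cvgB. Qed.

Let ck : cosh p.1 - coshx x (p.1 + s) @[p --> F] --> cosh b - coshx x (b + s).
Proof. by apply: cvgB => //; exact: ccosh. Qed.

Let cw : weight s p.1 p.2 @[p --> F] --> weight s b a.
Proof.
apply: cexp; apply: cvgB; first exact: cvgM.
by apply: cvgM => //; exact: cvg_cst.
Qed.

Let carg : (ratio p.1 p.2 - iratio p.1 p.2) / N @[p --> F]
  --> (ratio b a - iratio b a) / N.
Proof. by apply: cvgM; [exact: cvgB|exact: cvg_cst]. Qed.

Let cc : cutoff N p.1 p.2 @[p --> F] --> cutoff N b a.
Proof. exact: (ccomp (@continuous_bump R)). Qed.

Let cdc : dcutoff N p.1 p.2 @[p --> F] --> dcutoff N b a.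
Proof.
apply: cvgM; first exact: (ccomp (@continuous_dbump R)).
by apply: cvgM; [exact: cvgD|exact: cvg_cst].
Qed.

Let cqs : q (p.1 + s) @[p --> F] --> q (b + s). Proof. exact: ccomp. Qed.
Let cdqs : dq (p.1 + s) @[p --> F] --> dq (b + s). Proof. exact: ccomp. Qed.

Let cT : Theta s p.1 p.2 @[p --> F] --> Theta s b a.
Proof. by apply: cvgM => //; exact: cvgM. Qed.

Let cT1 : Theta1 s p.1 p.2 @[p --> F] --> Theta1 s b a.
Proof.
apply: cvgM => //; apply: cvgM => //; apply: cvgD => //; apply: cvgM => //.
apply: cvgB; last exact: cvg_cst.
by apply: cvgM => //; apply: cvgB => //; exact: csinh.
Qed.

Let cT2 : Theta2 s p.1 p.2 @[p --> F] --> Theta2 s b a.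
Proof.
apply: cvgM; last exact: cvgM.
by apply: cvgD => //; apply: cvgM => //; exact: cvgM.
Qed.

Let cE : expR (- ln p.2) @[p --> F] --> expR (- ln a).
Proof. by apply: cexp; exact: cvgN. Qed.

Lemma continuous_Phi :
  [/\ (fun p : R * R => Phi s p.1 p.2) p @[p --> (b, a)] --> Phi s b a,
      (fun p : R * R => Phi1 s p.1 p.2) p @[p --> (b, a)] --> Phi1 s b a &
      (fun p : R * R => Phi2 s p.1 p.2) p @[p --> (b, a)] --> Phi2 s b a].
Proof.
split; first exact: cvgM.
  by apply: cvgM => //; exact: cvgD.
apply: cvgN; apply: cvgM; last exact: cvgD.
by rewrite expr2; under eq_fun do rewrite expr2; exact: cvgM.
Qed.

End continuity.

Let Y w := B t w + mu * t.
Let A := expBM_functional B mu t.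

Let mYA : measurable_fun setT (fun w => (Y w, A w)).
Proof.
apply/measurable_fun_pair; last exact: (measurable_expBM hB mu t_gt0).
by apply: measurable_funD => //; apply: (measurable_BM hB); exact: ltW.
Qed.

Let A_gt0 w : 0 < A w. Proof. exact: (expBM_functional_gt0 hB mu t_gt0 w). Qed.

Let integrable_dTheta s : P.-integrable setT (EFin \o (fun w => dTheta s (Y w) (A w))).
Proof.
have [C C0 hC] := Theta_bounds `|s|.
apply: (@bounded_integrable _ _ _ P _ C).
  exact: (measurableT_comp (measurable_dTheta s) mYA).
by move=> w; have [] := hC s (Y w) (A w) (lexx _) (A_gt0 w).
Qed.

Let integrable_Theta s : P.-integrable setT (EFin \o (fun w => Theta s (Y w) (A w))).
Proof.
have [C C0 hC] := Theta_bounds `|s|.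
apply: (@bounded_integrable _ _ _ P _ C).
  exact: (measurableT_comp (measurable_Theta s) mYA).
by move=> w; have [] := hC s (Y w) (A w) (lexx _) (A_gt0 w).
Qed.

(** The integrand of [stein_identity] for [Phi s] is exactly [- 2 * dTheta s]. The terms [Theta2]
    cancel between the y and a derivatives because r is invariant, and (e^(2y) - 1) / a = 2 r sinh y
    cancels the derivative of the factor e^(r cosh y). Since y and s otherwise enter through y + s,
    what is left is a derivative in s. *)
Lemma integral_dTheta s : (\int[P]_w (dTheta s (Y w) (A w))%:E = 0)%E.
Proof.
have [C C0 hC] := Theta_bounds `|s|.
have [LL hL] := Theta_support (normr_ge0 s).
have Phi0 y a : 0 <= Phi s y a.
  by rewrite mulr_ge0 ?expR_ge0// mulr_ge0 ?bump_ge0// mulr_ge0 ?expR_ge0.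
have bP y a : 0 < a -> [/\ `|Phi s y a| <= C, `|Phi1 s y a| <= C & `|Phi2 s y a| <= C].
  by move=> a0; have [] := hC s y a (lexx _) a0.
have := @stein_identity R d T P B hB mu t t_gt0 (Phi s) (Phi1 s) (Phi2 s) C LL
  (measurable_Phi s) Phi0 (@dPhi s) bP (fun y a => (hL s y a (lexx _)).1)
  (fun y a => (hL s y a (lexx _)).2) (fun y a a0 => @continuous_Phi y a s a0).
rewrite /=; set f := (X in (\int[P]_w (X w)%:E)%E).
have fE w : f w = - 2 * dTheta s (Y w) (A w).
  rewrite /f -/(A w) -/(Y w).
  have a0 : 0 < A w := expBM_functional_gt0 hB mu t_gt0 w.
  set y := Y w; set a := A w.
  have Ea : a * expR (- ln a) = 1 by rewrite expRN lnK// divff// gt_eqF.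
  have Er : ratio y a = expR y * expR (- ln a) by rewrite /ratio -expRD.
  have Ey : expR y * expR (- y) = 1 by rewrite -expRD subrr expR0.
  have E2 : expR (2 * y) = expR y * expR y by rewrite -expRD; congr expR; ring.
  have H1 : (expR (2 * y) - 1) * Phi s y a = 2 * ratio y a * sinh y * Theta s y a.
    rewrite /Phi E2 Er /sinh.
    transitivity (expR (- ln a) * (expR y * expR y - expR y * expR (- y)) * Theta s y a).
      by rewrite Ey; ring.
    by field.
  have H2 : a * (2 * (1 + mu) * Phi s y a + 2 * Phi1 s y a)
      = 2 * (1 + mu) * Theta s y a + 2 * (Theta1 s y a + Theta2 s y a).
    transitivity (a * expR (- ln a) * (2 * (1 + mu) * Theta s y a
      + 2 * (Theta1 s y a + Theta2 s y a))); first by rewrite /Phi /Phi1; ring.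
    by rewrite Ea mul1r.
  have H3 : a ^+ 2 / 2 * (4 * Phi2 s y a) = - 2 * (Theta s y a + Theta2 s y a).
    transitivity (- 2 * (a * expR (- ln a)) ^+ 2 * (Theta s y a + Theta2 s y a)).
      by rewrite /Phi2; field.
    by rewrite Ea expr1n mulr1.
  rewrite H1 H2 H3 /dTheta /Theta1 /Theta.
  by field.
under eq_integral do rewrite fE EFinM.
rewrite (integralZl measurableT (integrable_dTheta s)) => /eqP.
by rewrite mule_eq0 eqe oppr_eq0 pnatr_eq0/= => /eqP.
Qed.

Let is_derive_Theta (s y a : R) : is_derive s 1 (fun s => Theta s y a) (dTheta s y a).
Proof.
have h0 : is_derive s 1 (fun s => y + s) 1.
  have h : is_derive s 1 (cst y + id) (0 + 1) :=
    is_deriveD (is_derive_cst y s 1) (is_derive_id s 1).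
  by move: h; rewrite add0r.
have hN : is_derive s 1 (fun s => - (y + s)) (- 1) by exact: is_deriveN.
have hq := is_derive_comp_eq dqE h0.
have h1 := is_derive_expR_comp h0; have h2 := is_derive_expR_comp hN.
have hk : is_derive s 1 (fun s => coshx x (y + s)) (dcoshx x (y + s)).
  rewrite /coshx /cosh; apply: is_derive_eq.
  by rewrite /GRing.scale/= /dcoshx /sinh; ring.
have hw : is_derive s 1 (fun s => weight s y a)
    (weight s y a * - (ratio y a * dcoshx x (y + s))).
  apply: is_derive_expR_comp; apply: is_derive_eq.
  by rewrite /GRing.scale/=; ring.
rewrite /Theta; apply: is_derive_eq.
by rewrite /GRing.scale/= /dTheta; ring.
Qed.

(** The expectation has derivative 0 in s by [integral_dTheta]; [Theta_bounds] on ]s - 1, s + 1[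
    justifies differentiating under the integral. *)
Lemma Theta_translation h :
  (\int[P]_w (Theta 0 (Y w) (A w))%:E = \int[P]_w (Theta h (Y w) (A w))%:E)%E.
Proof.
pose f s w := Theta s (Y w) (A w).
pose F s := Rintegral P setT (f s).
have intE s : (\int[P]_w (f s w)%:E = (F s)%:E)%E.
  by rewrite /F /Rintegral fineK//; exact: (integrable_fin_num measurableT (integrable_Theta s)).
suff dF (s : R) : is_derive s 1 F 0.
  by rewrite !intE; congr EFin; exact: (is_derive_0_is_cst _ _ dF).
pose S := `|s| + 1.
have [C C0 hC] := Theta_bounds S.
have sI : `]s - 1, s + 1[%classic s.
  by rewrite /= in_itv/= ltrBlDr !ltrDl ltr01.
have IS z : `]s - 1, s + 1[%classic z -> `|z| <= S.
  rewrite /= in_itv/= /S => /andP[h1 h2].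
  have -> : z = s + (z - s) by rewrite addrC subrK.
  by rewrite (le_trans (ler_normD _ _))// lerD2l ler_norml; lra.
have d1E z w : partial1of2 f z w = dTheta z (Y w) (A w).
  by rewrite partial1of2E; have [_ ->] := is_derive_Theta z (Y w) (A w).
have intf z : `]s - 1, s + 1[%classic z -> P.-integrable setT (EFin \o f z).
  by move=> _; exact: integrable_Theta.
have derf z w : `]s - 1, s + 1[%classic z -> setT w -> derivable (f ^~ w) z 1.
  by move=> _ _; have [] := is_derive_Theta z (Y w) (A w).
have intG : P.-integrable setT (EFin \o (fun _ : T => C)).
  by apply: (@bounded_integrable _ _ _ P _ `|C|).
have Gub z w : `]s - 1, s + 1[%classic z -> setT w -> `|partial1of2 f z w| <= C.
  move=> /IS zS _; rewrite d1E.
  by have [] := hC z (Y w) (A w) zS (A_gt0 w).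
have D1 := @derivable_under_integral R d T P f setT measurableT s _ _ sI intf derf
  (fun=> C) (fun=> C0) intG Gub.
have D2 := @differentiation_under_integral R d T P f setT measurableT s _ _ sI intf derf
  (fun=> C) (fun=> C0) intG Gub.
apply: DeriveDef D1 _; rewrite -derive1E D2 /Rintegral.
under eq_integral do rewrite d1E.
by rewrite integral_dTheta.
Qed.

End translation.

Ltac ge0 := repeat first
  [exact: bump_ge0|exact: expR_ge0|by auto|apply: mulr_ge0].

Lemma cvg_integral_nondecreasing (R : realType) d' (S : measurableType d')
    (m : {measure set S -> \bar R}) (g : nat -> S -> \bar R) (l : S -> \bar R) :
  (forall n, measurable_fun setT (g n)) -> (forall n s, 0 <= g n s)%E ->
  (forall s, nondecreasing_seq (g ^~ s)) ->
  (forall s, g n s @[n --> \oo] --> l s) ->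
  (\int[m]_s g n s)%E @[n --> \oo] --> (\int[m]_s l s)%E.
Proof.
move=> mg g0 ndg gl.
have -> : l = (fun s => limn (g ^~ s)) by apply/funext => s; exact/esym/cvg_lim.
by apply: cvg_monotone_convergence => //.
Qed.

(** * The mass of the bump *)

Section bump_mass.
Context (R : realType).
Notation leb := (@lebesgue_measure R).

Definition bump_mass : R := fine (\int[leb]_u (bump u)%:E).

Lemma measurable_bump : measurable_fun setT (@bump R).
Proof. by apply: continuous_measurable_fun; exact: continuous_bump. Qed.

Lemma integral_bump_bounds (m v : R) : 0 < v ->
  (0 < \int[leb]_u (bump ((u - m) / v))%:E < +oo)%E.
Proof.
move=> v0.
have mb : measurable_fun setT (fun u : R => bump ((u - m) / v)).
  apply: (measurableT_comp measurable_bump); apply: measurable_funM => //.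
  exact: measurable_funB.
have b1 : (1 : R) = bump 0 by rewrite /bump expr0n/= subr0 max_r// expr1n.
have nE (u : R) : `|(u - m) / v| = `|u - m| / v.
  by rewrite normrM [X in _ * X]gtr0_norm// invr_gt0.
apply/andP; split.
  pose c := bump (2^-1 : R).
  have c0 : 0 < c by apply: bump_gt0; rewrite ger0_norm// invf_lt1// ltr1n.
  apply: (@lt_le_trans _ _ (\int[leb]_u
      (c%:E * (\1_(`[m - v / 2, m + v / 2]%classic : set R) u)%:E))%E).
    rewrite ge0_integralZl//; last 2 first.
    - by apply/measurable_EFinP; exact: measurable_indic.
    - by rewrite lee_fin ltW.
    rewrite integral_indic//= setIT lebesgue_measure_itv/= lte_fin.
    have mm : m - v / 2 < m + v / 2 by lra.
    by rewrite mm -EFinB -EFinM lte_fin mulr_gt0// subr_gt0.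
  apply: ge0_le_integral => //.
  - by move=> u _; rewrite -EFinM lee_fin mulr_ge0// ?ltW// indicE.
  - apply/measurable_EFinP; apply: measurable_funM => //.
  - exact/measurable_EFinP.
  - move=> u _; rewrite -EFinM lee_fin indicE.
    have [/set_mem|_] := boolP (u \in _); last by rewrite mulr0 bump_ge0.
    rewrite /= in_itv/= mulr1 => /andP[h1 h2]; apply: bump_antitone.
    rewrite nE [X in _ <= X]ger0_norm// ler_pdivrMr// ler_norml; apply/andP; split; lra.
apply: (@le_lt_trans _ _ (\int[leb]_u (\1_(`[m - v, m + v]%classic : set R) u)%:E)%E).
  apply: ge0_le_integral => //.
  - by move=> u _; rewrite lee_fin bump_ge0.
  - exact/measurable_EFinP.
  - by apply/measurable_EFinP; exact: measurable_indic.
  - move=> u _; rewrite lee_fin indicE; have [u1|u1] := leP `|(u - m) / v| 1.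
      rewrite mem_set/=; last first.
        move: u1; rewrite nE ler_pdivrMr// mul1r in_itv/= ler_norml => /andP[h1 h2].
        by apply/andP; split; lra.
      by rewrite [leRHS]b1; apply: bump_antitone; rewrite normr0.
    by have [-> _] := bump_out u1.
rewrite integral_indic//= setIT lebesgue_measure_itv/=; case: ifP => _; last exact: ltry.
by rewrite -EFinB ltry.
Qed.

Let bump_integral : (0 < \int[leb]_u (bump u)%:E < +oo)%E.
Proof.
have := @integral_bump_bounds 0 1 ltr01.
by under eq_integral do rewrite subr0 divr1.
Qed.

Lemma bump_massE : (\int[leb]_u (bump u)%:E = bump_mass%:E)%E.
Proof.
have /andP[h1 h2] := bump_integral.
by rewrite /bump_mass fineK// ge0_fin_numE// ltW.
Qed.

Lemma bump_mass_gt0 : 0 < bump_mass.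
Proof. by rewrite /bump_mass fine_gt0. Qed.

End bump_mass.

(** * The kernel identity, with and without cutoff *)

Section kernel.
Context (R : realType) (d : measure_display) (T : measurableType d).
Variables (P : probability T R) (B : R -> T -> R).
Hypothesis hB : is_standard_BM P B.
Variables (mu t : R).
Hypothesis t_gt0 : 0 < t.
Notation leb := (@lebesgue_measure R).

Let Y w := B t w + mu * t.
Let A := expBM_functional B mu t.
Let r w := ratio (Y w) (A w).

Let mY : measurable_fun setT Y.
Proof. by apply: measurable_funD => //; apply: (measurable_BM hB); exact: ltW. Qed.

Let mA : measurable_fun setT A.
Proof. exact: (measurable_expBM hB mu t_gt0). Qed.

Let mlnA : measurable_fun setT (fun w => ln (A w)).
Proof. exact: (measurableT_comp (@measurable_ln R) mA). Qed.

Let mr : measurable_fun setT r.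
Proof. by apply: measurableT_comp => //; exact: measurable_funB. Qed.

Let mir : measurable_fun setT (fun w => iratio (Y w) (A w)).
Proof. by apply: measurableT_comp => //; exact: measurable_funB. Qed.

Local Notation bump_mass := (bump_mass R).

Let mbump : measurable_fun setT (@bump R).
Proof. exact: measurable_bump. Qed.

(** The parameter x and the point z will enter only through C = [coshx x z]; this is what transfers
    information from x = 0 to x > 0. *)
Definition kernel (N C : R) : \bar R :=
  \int[P]_w (cutoff N (Y w) (A w) *
    (expR (r w * (cosh (Y w) - C) - mu * Y w) * bump (Y w)))%:E.

Let bump_even (u v : R) : bump (u - v) = bump (v - u).
Proof. by rewrite -opprB /bump sqrrN. Qed.

Let mcosh : measurable_fun setT (@cosh R).
Proof.
apply: measurable_funM => //; apply: measurable_funD => //.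
by apply: measurableT_comp => //; exact: measurable_funN.
Qed.

Let mcoshx (x : R) : measurable_fun setT (coshx x).
Proof.
apply: measurable_funD => //; apply: measurable_funM => //.
by apply: measurableT_comp => //; exact: measurable_funN.
Qed.

Let mcut N : measurable_fun setT (fun w => cutoff N (Y w) (A w)).
Proof.
apply: (measurableT_comp mbump); apply: measurable_funM => //.
exact: measurable_funB.
Qed.

(** For translation 0 the integrand contains [bump (h - Y w)], which integrates to [bump_mass] in h.
    For translation h it contains [bump (Y w)] and depends on h only through z = h + Y, so a change
    of variable under Tonelli frees [f] and [coshx] from the randomness. *)
Lemma kernel_identity_cutoff (N x : R) (f df : R -> R) :
  0 < N -> 0 <= x -> (forall y, 0 <= f y) ->
  (forall y : R, is_derive y 1 f (df y)) -> continuous df ->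
  (\int[P]_w (cutoff N (Y w) (A w) *
     (expR (- (x * (r w * expR (- Y w)))) * f (Y w) * bump_mass))%:E
   = \int[leb]_z ((f z * expR (mu * z))%:E * kernel N (coshx x z)))%E.
Proof.
move=> N0 x0 f0 hf cdf.
have cf : continuous f.
  by move=> y; apply/differentiable_continuous/derivable1_diffP; have [] := hf y.
have mf : measurable_fun setT f by exact: continuous_measurable_fun.
(* The factor e^(mu y) compensates the e^(-mu Y) of [weight] at translation 0; at translation h it
   becomes the deterministic e^(mu z). *)
pose q h y := f y * (bump (y - h) * expR (mu * y)).
pose dq h y := df y * (bump (y - h) * expR (mu * y))
  + f y * (dbump (y - h) * expR (mu * y) + bump (y - h) * (mu * expR (mu * y))).
have hq h (y : R) : is_derive y 1 (q h) (dq h y).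
  have h1 : is_derive y 1 (fun z => z - h) 1.
    by apply: is_derive_eq; rewrite subr0.
  have h2 := is_derive_comp_eq (@is_derive_bump R) h1.
  have h3 : is_derive y 1 (fun z => mu * z) mu.
    by apply: is_derive_eq; rewrite /GRing.scale/= mulr1.
  have h4 := is_derive_expR_comp h3; have h5 := hf y.
  rewrite /q; apply: is_derive_eq; rewrite /GRing.scale/= /dq.
  by ring.
have cexp : continuous (fun z : R => expR (mu * z)).
  move=> z; apply: (@cvg_comp _ _ _ (fun z : R => mu * z) expR); last exact: continuous_expR.
  by apply: cvgM; [exact: cvg_cst|exact: cvg_id].
have csub h : continuous (fun z : R => z - h).
  by move=> z; apply: cvgB; [exact: cvg_id|exact: cvg_cst].
have cb h : continuous (fun z : R => bump (z - h)).
  by move=> z; apply: (@cvg_comp _ _ _ (fun z : R => z - h) (@bump R));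
    [exact: csub|exact: continuous_bump].
have cdb h : continuous (fun z : R => dbump (z - h)).
  by move=> z; apply: (@cvg_comp _ _ _ (fun z : R => z - h) (@dbump R));
    [exact: csub|exact: continuous_dbump].
have cdq h : continuous (dq h).
  move=> z; apply: cvgD; apply: cvgM; first exact: cdf.
  - by apply: cvgM; [exact: cb|exact: cexp].
  - exact: cf.
  apply: cvgD; apply: cvgM; [exact: cdb|exact: cexp|exact: cb|].
  by apply: cvgM; [exact: cvg_cst|exact: cexp].
have q0 h y : 0 <= q h y by rewrite /q; ge0.
have qout h y : `|h| + 1 < `|y| -> q h y = 0 /\ dq h y = 0.
  move=> hy; have : 1 < `|y - h|.
    have := ler_distD h y 0; rewrite !subr0; lra.
  by move/bump_out => [b0 db0]; rewrite /q /dq b0 db0 !(mul0r, mulr0, addr0).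
pose G w := cutoff N (Y w) (A w) * (expR (- (x * (r w * expR (- Y w)))) * f (Y w)).
pose H w z := cutoff N (Y w) (A w) *
    (expR (r w * (cosh (Y w) - coshx x z) - mu * Y w) * bump (Y w))
  * (f z * expR (mu * z)).
have mfst : measurable_fun setT (fun p : T * R => Y p.1).
  by apply: measurableT_comp.
have mG : measurable_fun setT G.
  apply: measurable_funM => //; apply: measurable_funM.
    apply: measurableT_comp => //; apply: measurable_funN.
    apply: measurable_funM => //; apply: measurable_funM => //.
    by apply: measurableT_comp => //; exact: measurable_funN.
  exact: measurableT_comp.
have G0 w : 0 <= G w by rewrite /G; ge0.
have H0 w z : 0 <= H w z by rewrite /H; ge0.
have mH : measurable_fun setT (fun p : T * R => H p.1 p.2).
  apply: measurable_funM; last first.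
    apply: measurable_funM; first exact: (measurableT_comp mf).
    by apply: measurableT_comp => //; exact: measurable_funM.
  apply: measurable_funM; first exact: (measurableT_comp (mcut N)).
  apply: measurable_funM; last exact: (measurableT_comp mbump).
  apply: measurableT_comp => //; apply: measurable_funB; last exact: measurable_funM.
  apply: measurable_funM; first exact: (measurableT_comp mr).
  apply: measurable_funB; first exact: (measurableT_comp mcosh).
  exact: (measurableT_comp (mcoshx x)).
have trans h : (\int[P]_w (G w * bump (h - Y w))%:E = \int[P]_w (H w (h + Y w))%:E)%E.
  have T0 w : Theta mu N x (q h) 0 (Y w) (A w) = G w * bump (h - Y w).
    rewrite /Theta /G /weight -/(r w) !addr0 /q bump_even.
    have -> : r w * (cosh (Y w) - coshx x (Y w)) - mu * Y w
      = - (x * (r w * expR (- Y w))) - mu * Y w by rewrite /coshx; ring.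
    rewrite expRD.
    have E : expR (- (mu * Y w)) * expR (mu * Y w) = 1.
      by rewrite -expRD addNr expR0.
    set e := expR (mu * Y w) in E *; set i := expR (- (mu * Y w)) in E *.
    transitivity (cutoff N (Y w) (A w) * (expR (- (x * (r w * expR (- Y w))))
      * f (Y w)) * bump (h - Y w) * (i * e)); first by ring.
    by rewrite E mulr1.
  have Th w : Theta mu N x (q h) h (Y w) (A w) = H w (h + Y w).
    rewrite /Theta /H /weight -/(r w) /q addrK [h + _]addrC.
    by ring.
  transitivity (\int[P]_w (Theta mu N x (q h) 0 (Y w) (A w))%:E)%E.
    by apply: eq_integral => w _; rewrite T0.
  rewrite (@Theta_translation R d T P B hB mu t t_gt0 N x (q h) (dq h) (`|h| + 1)
    N0 x0 (q0 h) (hq h) (cdq h) (qout h) h).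
  by apply: eq_integral => w _; rewrite Th.
have mS : measurable_fun setT (fun p : T * R => (G p.1 * bump (p.2 - Y p.1))%:E).
  apply/measurable_EFinP; apply: measurable_funM; first exact: (measurableT_comp mG).
  by apply: (measurableT_comp mbump); exact: measurable_funB.
have mHs : measurable_fun setT (fun p : T * R => (H p.1 (p.2 + Y p.1))%:E).
  apply/measurable_EFinP.
  apply: (measurableT_comp mH (g := fun p : T * R => (p.1, p.2 + Y p.1))).
  by apply/measurable_fun_pair => //=; exact: measurable_funD.
have mHE : measurable_fun setT (fun p : T * R => (H p.1 p.2)%:E) by exact/measurable_EFinP.
transitivity (\int[P]_w \int[leb]_h (G w * bump (h - Y w))%:E)%E.
  apply: eq_integral => w _.
  under [RHS]eq_integral do rewrite EFinM.
  rewrite ge0_integralZl//; last first.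
  - by rewrite lee_fin.
  - by move=> z _; rewrite lee_fin bump_ge0.
  - apply/measurable_EFinP; apply: (measurableT_comp mbump).
    exact: measurable_funB.
  have := @ge0_integral_shift R (- Y w) (fun u => (bump u)%:E).
  rewrite (bump_massE R) => ->; first by rewrite -EFinM /G; congr EFin; ring.
  - exact/measurable_EFinP.
  - by move=> u; rewrite lee_fin bump_ge0.
rewrite (@fubini_tonelli _ _ T (measurableTypeR R) R P leb
  (fun p => (G p.1 * bump (p.2 - Y p.1))%:E))//=; last first.
  by move=> p; rewrite lee_fin mulr_ge0// bump_ge0.
under eq_integral do rewrite trans.
rewrite -(@fubini_tonelli _ _ T (measurableTypeR R) R P leb
  (fun p => (H p.1 (p.2 + Y p.1))%:E))//=; last first.
  by move=> p; rewrite lee_fin.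
transitivity (\int[P]_w \int[leb]_z (H w z)%:E)%E.
  apply: eq_integral => w _.
  apply: (@ge0_integral_shift R (Y w) (fun z => (H w z)%:E)).
    apply/measurable_EFinP; apply: (measurableT_comp mH (g := fun z : R => (w, z))).
    by apply/measurable_fun_pair; [exact: measurable_cst|exact: measurable_id].
  by move=> z; rewrite lee_fin.
rewrite (@fubini_tonelli _ _ T (measurableTypeR R) R P leb
  (fun p => (H p.1 p.2)%:E))//=; last by move=> p; rewrite lee_fin.
apply: eq_integral => z _; rewrite /H.
under eq_integral do rewrite EFinM muleC.
rewrite ge0_integralZl//; last first.
- by rewrite lee_fin mulr_ge0// expR_ge0.
- by move=> w _; rewrite lee_fin; ge0.
apply/measurable_EFinP; apply: measurable_funM => //; apply: measurable_funM.
  apply: measurableT_comp => //; apply: measurable_funB; last exact: measurable_funM.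
  apply: measurable_funM => //; apply: measurable_funB => //.
  exact: (measurableT_comp mcosh).
exact: (measurableT_comp mbump).
Qed.

(** Extended real, since integrability of e^(r (cosh Y - C)) is not known beforehand; for C > 1
    finiteness comes out of [kern_cosh]. *)
Definition kern (C : R) : \bar R :=
  \int[P]_w (expR (r w * (cosh (Y w) - C) - mu * Y w) * bump (Y w))%:E.

Let nd_cut y a : nondecreasing_seq (fun n => cutoff n.+1%:R y a : R).
Proof.
apply/nondecreasing_seqP => n; apply: bump_antitone.
rewrite !normrM ler_wpM2l// !ger0_norm// ?invr_ge0// lef_pV2 ?posrE//.
by rewrite ler_nat.
Qed.

Let cvg_cut y a : cutoff n.+1%:R y a @[n --> \oo] --> (1 : R).
Proof. exact: cvg_bump_scale. Qed.

Let cvg_integral_cut (g : T -> R) : measurable_fun setT g -> (forall w, 0 <= g w) ->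
  (\int[P]_w (cutoff n.+1%:R (Y w) (A w) * g w)%:E)%E @[n --> \oo]
  --> (\int[P]_w (g w)%:E)%E.
Proof.
move=> mg g0; apply: cvg_integral_nondecreasing.
- by move=> n; apply/measurable_EFinP; exact: measurable_funM.
- by move=> n w; rewrite lee_fin mulr_ge0 ?bump_ge0.
- by move=> w n m nm; rewrite lee_fin ler_wpM2r// nd_cut.
- move=> w; apply: cvg_EFin; first exact: nearW.
  rewrite -[X in _ --> X]mul1r; apply: cvgM; [exact: cvg_cut|exact: cvg_cst].
Qed.

Let mkern_arg C : measurable_fun setT (fun w =>
  expR (r w * (cosh (Y w) - C) - mu * Y w) * bump (Y w)).
Proof.
apply: measurable_funM; last exact: (measurableT_comp mbump).
apply: measurableT_comp => //; apply: measurable_funB; last exact: measurable_funM.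
apply: measurable_funM => //; apply: measurable_funB => //.
exact: (measurableT_comp mcosh).
Qed.

Lemma cvg_kernel C : kernel n.+1%:R C @[n --> \oo] --> kern C.
Proof.
apply: cvg_integral_cut; first exact: mkern_arg.
by move=> w; rewrite mulr_ge0 ?expR_ge0 ?bump_ge0.
Qed.

Lemma kernel_ge0 N C : (0 <= kernel N C)%E.
Proof. by apply: integral_ge0 => w _; rewrite lee_fin; ge0. Qed.

Lemma kern_ge0 C : (0 <= kern C)%E.
Proof. by apply: integral_ge0 => w _; rewrite lee_fin; ge0. Qed.

Lemma measurable_kernel_coshx N x :
  measurable_fun setT (fun z : R => kernel N (coshx x z)).
Proof.
pose H (p : T * R) : \bar R := (cutoff N (Y p.1) (A p.1) *
  (expR (r p.1 * (cosh (Y p.1) - coshx x p.2) - mu * Y p.1) * bump (Y p.1)))%:E.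
have mfst : measurable_fun setT (fun p : T * R => Y p.1) by apply: measurableT_comp.
have mH : measurable_fun setT H.
  apply/measurable_EFinP.
  apply: measurable_funM; first exact: (measurableT_comp (mcut N)).
  apply: measurable_funM; last exact: (measurableT_comp mbump).
  apply: measurableT_comp => //; apply: measurable_funB; last exact: measurable_funM.
  apply: measurable_funM; first exact: (measurableT_comp mr).
  apply: measurable_funB; first exact: (measurableT_comp mcosh).
  exact: (measurableT_comp (mcoshx x)).
have H0 p : (0 <= H p)%E by rewrite lee_fin; ge0.
exact: (@measurable_fun_fubini_tonelli_G _ _ T R R P H mH H0).
Qed.

Lemma measurable_kern_coshx x :
  measurable_fun setT (fun z : R => kern (coshx x z)).
Proof.
apply: (emeasurable_fun_cvg (fun n (z : R) => kernel n.+1%:R (coshx x z))).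
- by move=> n; exact: measurable_kernel_coshx.
- by move=> z _; exact: cvg_kernel.
Qed.

(** The cutoffs increase to 1, so both sides of the cutoff identity pass to the limit
    monotonically. *)
Lemma kernel_identity (x : R) (f df : R -> R) :
  0 <= x -> (forall y, 0 <= f y) ->
  (forall y : R, is_derive y 1 f (df y)) -> continuous df ->
  (\int[P]_w (expR (- (x * (r w * expR (- Y w)))) * f (Y w) * bump_mass)%:E
   = \int[leb]_z ((f z * expR (mu * z))%:E * kern (coshx x z)))%E.
Proof.
move=> x0 f0 hf cdf.
have cf : continuous f.
  by move=> y; apply/differentiable_continuous/derivable1_diffP; have [] := hf y.
have mf : measurable_fun setT f by exact: continuous_measurable_fun.
have bm0 := ltW (bump_mass_gt0 R).
set g := fun w => expR (- (x * (r w * expR (- Y w)))) * f (Y w) * bump_mass.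
have mg : measurable_fun setT g.
  apply: measurable_funM => //; apply: measurable_funM; last exact: measurableT_comp.
  apply: measurableT_comp => //; apply: measurable_funN.
  apply: measurable_funM => //; apply: measurable_funM => //.
  by apply: measurableT_comp => //; exact: measurable_funN.
have g0 w : 0 <= g w by rewrite /g; ge0.
have L1 := cvg_integral_cut mg g0.
have L2 : (\int[leb]_z ((f z * expR (mu * z))%:E * kernel n.+1%:R (coshx x z)))%E
    @[n --> \oo] --> (\int[leb]_z ((f z * expR (mu * z))%:E * kern (coshx x z)))%E.
  apply: cvg_integral_nondecreasing.
  - move=> n; apply: emeasurable_funM; last exact: measurable_kernel_coshx.
    apply/measurable_EFinP; apply: measurable_funM; first exact: mf.
    by apply: measurableT_comp => //; exact: measurable_funM.
  - by move=> n z; rewrite mule_ge0 ?kernel_ge0// lee_fin; ge0.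
  - move=> z n m nm; apply: lee_wpmul2l; first by rewrite lee_fin; ge0.
    apply: ge0_le_integral => //.
    + by move=> w _; rewrite lee_fin; ge0.
    + by apply/measurable_EFinP; apply: measurable_funM => //; exact: mkern_arg.
    + by apply/measurable_EFinP; apply: measurable_funM => //; exact: mkern_arg.
    + by move=> w _; rewrite lee_fin ler_wpM2r ?nd_cut//; ge0.
  - by move=> z; apply: cvgeZl => //; exact: cvg_kernel.
have E n : (\int[P]_w (cutoff n.+1%:R (Y w) (A w) * g w)%:E
    = \int[leb]_z ((f z * expR (mu * z))%:E * kernel n.+1%:R (coshx x z)))%E.
  exact: (@kernel_identity_cutoff n.+1%:R x f df).
move: L2; under eq_fun do rewrite -E; move=> L2.
exact: (cvg_unique _ L1 L2).
Qed.

End kernel.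

(** * The Laplace transform of the inverse functional *)

Section laplace.
Context (R : realType) (d : measure_display) (T : measurableType d).
Variables (P : probability T R) (B : R -> T -> R).
Hypothesis hB : is_standard_BM P B.
Variables (mu t : R).
Hypothesis t_gt0 : 0 < t.
Notation leb := (@lebesgue_measure R).

Let Y w := B t w + mu * t.
Let A := expBM_functional B mu t.
Let r w := ratio (Y w) (A w).
Let K := kern P B mu t.
Let bm : R := bump_mass R.

Let sq_neq0 : Num.sqrt t != 0. Proof. by rewrite gt_eqF// sqrtr_gt0. Qed.

Let pdf (z : R) : R := normal_pdf 0 (Num.sqrt t) z.

Let pdfE z : pdf z = normal_peak (Num.sqrt t) * expR (- z ^+ 2 / (2 * t)).
Proof.
rewrite /pdf normal_pdfE// /normal_fun subr0 sqr_sqrtr ?(ltW t_gt0)//.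
by congr (_ * expR (_ / _)); rewrite mulr_natl.
Qed.

Let mpdf : measurable_fun setT pdf.
Proof. exact: measurable_normal_pdf. Qed.

Let pdf_ge0 z : 0 <= pdf z. Proof. exact: normal_pdf_ge0. Qed.

Lemma ge0_integral_BM (f : R -> \bar R) : measurable_fun setT f ->
  (forall x, 0 <= f x)%E ->
  (\int[P]_w f (B t w) = \int[leb]_z (f z * (pdf z)%:E))%E.
Proof.
move=> mf f0; rewrite -ge0_integral_normal//.
have [B0 _ mB hinc] := hB.
have mBt := mB t (ltW t_gt0).
pose X : {mfun T >-> measurableTypeR R} :=
  HB.pack (B t : T -> measurableTypeR R) (isMeasurableFun.Build _ _ _ (measurableTypeR R) _ mBt).
have -> : (\int[P]_w f (B t w) = \int[distribution P X]_z f z)%E.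
  by rewrite ge0_integral_distribution.
apply: eq_measure_integral => D mD _.
(* A grid with the single increment from 0 to t gives the law of B_t. *)
pose g (k : nat) := k%:R * t.
have g0 : g 0%N = 0 by rewrite /g mul0r.
have g1 : g 1%N = t by rewrite /g mul1r.
have gl i : (i < 1)%N -> g i < g i.+1 by case: i => // _; rewrite g0 g1.
have := hinc 1%N g (fun=> D) g0 gl (fun _ _ => mD).
rewrite big_ord_recl big_ord0 mule1/= g1 g0 subr0 => <-.
congr (P _); apply/seteqP; split => w.
  by move=> Dw i /=; rewrite ltnS leqn0 => /eqP ->; rewrite g1 g0 B0 subr0.
by move=> /(_ 0%N isT) /=; rewrite g1 g0 B0 subr0.
Qed.

(** The density of Y = B_t + mu t at z is e^(mu z) times [nhat z]. Once the drift is split off, what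
    remains decreases on the positive half-line; its factor e^(-t mu^2 / 2) is the prefactor of
    [G]. *)
Let nhat (z : R) : R := pdf z * expR (- (t * mu ^+ 2) / 2).

Let pdf_shift z : pdf (z - mu * t) = expR (mu * z) * nhat z.
Proof.
rewrite /nhat !pdfE mulrCA -!mulrA -!expRD; congr (_ * expR _).
by field; rewrite gt_eqF.
Qed.

Let nhat_antitone (z1 z2 : R) : 0 < z1 -> z1 <= z2 -> nhat z2 <= nhat z1.
Proof.
move=> z10 z12; rewrite /nhat ler_wpM2r ?expR_ge0// !pdfE.
rewrite ler_wpM2l ?normal_peak_ge0// ler_expR !mulNr lerN2.
rewrite ler_wpM2r ?invr_ge0 ?mulr_ge0 ?(ltW t_gt0)//.
by rewrite lerXn2r ?nnegrE ?(ltW z10)// (le_trans (ltW z10)).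
Qed.

Let continuous_nhat : continuous nhat.
Proof.
move=> z; apply: cvgM; last exact: cvg_cst.
exact: continuous_normal_pdf.
Qed.

Let mY : measurable_fun setT Y.
Proof. by apply: measurable_funD => //; apply: (measurable_BM hB); exact: ltW. Qed.

Let mlnA : measurable_fun setT (fun w => ln (A w)).
Proof. exact: (measurableT_comp (@measurable_ln R) (measurable_expBM hB mu t_gt0)). Qed.

Let mr : measurable_fun setT r.
Proof. by apply: measurableT_comp => //; exact: measurable_funB. Qed.

Let K_antitone C1 C2 : C1 <= C2 -> (K C2 <= K C1)%E.
Proof.
move=> C12.
have mk C : measurable_fun setT (fun w =>
    (expR (r w * (cosh (Y w) - C) - mu * Y w) * bump (Y w))%:E).
  apply/measurable_EFinP; apply: measurable_funM; last first.
    apply: (measurableT_comp _ mY).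
    by apply: continuous_measurable_fun; exact: continuous_bump.
  apply: measurableT_comp => //; apply: measurable_funB; last exact: measurable_funM.
  apply: measurable_funM => //; apply: measurable_funB => //.
  apply: measurable_funM => //; apply: measurable_funD; apply: measurableT_comp => //.
  exact: measurable_funN.
apply: ge0_le_integral => //.
- by move=> w _; rewrite lee_fin mulr_ge0 ?expR_ge0 ?bump_ge0.
- move=> w _; rewrite lee_fin; apply: ler_wpM2r; first exact: bump_ge0.
  rewrite ler_expR lerD2r; apply: ler_wpM2l; first exact: expR_ge0.
  by rewrite lerD2l lerN2.
Qed.

Let cosh_homo (z1 z2 : R) : 0 < z1 -> z1 <= z2 -> cosh z1 <= cosh z2.
Proof.
move=> z10 z12; rewrite /cosh ler_wpM2r// !expRN.
set u := expR z1; set v := expR z2.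
have u1 : 1 <= u by rewrite -expR0 ler_expR ltW.
have uv : u <= v by rewrite ler_expR.
have u0 : 0 < u := expR_gt0 _; have v0 : 0 < v := expR_gt0 _.
rewrite -subr_ge0.
have -> : v + v^-1 - (u + u^-1) = (v - u) * (u * v - 1) / (u * v).
  by field; rewrite !gt_eqF.
apply: divr_ge0; last by rewrite mulr_ge0 ?(ltW u0) ?(ltW v0).
by apply: mulr_ge0; rewrite subr_ge0// mulr_ege1// (le_trans u1).
Qed.

(** The case x = 0 of [kernel_identity] for the test function f(z) e^(-mu z): its left-hand side
    involves only Y, whose density then contributes exactly [nhat]. *)
Let K_bump (z1 z2 : R) : 0 < z1 -> z1 < z2 ->
  let f (z : R) := bump ((z - (z1 + z2) / 2) / ((z2 - z1) / 2)) in
  (\int[leb]_z ((f z)%:E * (bm * nhat z)%:E)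
   = \int[leb]_z ((f z)%:E * K (cosh z)))%E.
Proof.
move=> z10 z12 f.
pose m := (z1 + z2) / 2; pose v := (z2 - z1) / 2.
have v0 : 0 < v by rewrite divr_gt0// subr_gt0.
pose df z := dbump ((z - m) / v) * v^-1.
have hf (y : R) : is_derive y 1 f (df y).
  have h1 : is_derive y 1 (fun z => (z - m) / v) v^-1.
    by apply: is_derive_eq; rewrite /GRing.scale/=; ring.
  exact: (is_derive_comp_eq (@is_derive_bump R) h1).
have carg : continuous (fun z : R => (z - m) / v).
  move=> z; apply: cvgM; last exact: cvg_cst.
  by apply: cvgB; [exact: cvg_id|exact: cvg_cst].
have cdf : continuous df.
  move=> z; apply: cvgM; last exact: cvg_cst.
  by apply: (@cvg_comp _ _ _ (fun z : R => (z - m) / v) (@dbump R));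
    [exact: carg|exact: continuous_dbump].
have cf : continuous f.
  by move=> z; apply: (@cvg_comp _ _ _ (fun z : R => (z - m) / v) (@bump R));
    [exact: carg|exact: continuous_bump].
have mf : measurable_fun setT f by exact: continuous_measurable_fun.
pose g z := f z * expR (- (mu * z)).
pose dg z := df z * expR (- (mu * z)) + f z * (- mu * expR (- (mu * z))).
have cex : continuous (fun z : R => expR (- (mu * z))).
  move=> z; apply: (@cvg_comp _ _ _ (fun z : R => - (mu * z)) expR);
    last exact: continuous_expR.
  by apply: cvgN; apply: cvgM; [exact: cvg_cst|exact: cvg_id].
have hg (y : R) : is_derive y 1 g (dg y).
  have h1 : is_derive y 1 (fun z => - (mu * z)) (- mu).
    by apply: is_derive_eq; rewrite /GRing.scale/=; ring.
  have h2 := is_derive_expR_comp h1; have h3 := hf y.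
  by rewrite /g; apply: is_derive_eq; rewrite /GRing.scale/= /dg; ring.
have cdg : continuous dg.
  move=> z; apply: cvgD; apply: cvgM; [exact: cdf|exact: cex|exact: cf|].
  by apply: cvgM; [exact: cvg_cst|exact: cex].
have g0 y : 0 <= g y by rewrite mulr_ge0 ?bump_ge0 ?expR_ge0.
have bm0 : 0 <= bm by rewrite ltW// bump_mass_gt0.
have mg : measurable_fun setT g.
  apply: measurable_funM => //; apply: measurableT_comp => //.
  by apply: measurable_funN; exact: measurable_funM.
have := @kernel_identity R d T P B hB mu t t_gt0 0 g dg (lexx 0) g0 hg cdg.
rewrite -/K => E.
have -> : (\int[leb]_z ((f z)%:E * K (cosh z))
  = \int[leb]_z ((g z * expR (mu * z))%:E * K (coshx 0 z)))%E.
  apply: eq_integral => z _; rewrite /coshx mul0r addr0 /g -mulrA -expRD.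
  by rewrite addNr expR0 mulr1.
rewrite -E.
transitivity (\int[P]_w (g (B t w + mu * t) * bm)%:E)%E; last first.
  by apply: eq_integral => w _; rewrite mul0r oppr0 expR0 mul1r.
rewrite (@ge0_integral_BM (fun u => (g (u + mu * t) * bm)%:E)); last 2 first.
- apply/measurable_EFinP; apply: measurable_funM => //.
  by apply: (measurableT_comp mg); exact: measurable_funD.
- by move=> u; rewrite lee_fin mulr_ge0.
rewrite -[LHS](@ge0_integral_shift R (mu * t)); last 2 first.
- apply/measurable_EFinP; apply: measurable_funM => //.
  apply: measurable_funM => //; exact: measurable_funM.
- move=> z; rewrite -EFinM lee_fin; apply: mulr_ge0; first exact: bump_ge0.
  by apply: mulr_ge0 => //; apply: mulr_ge0 => //; exact: expR_ge0.
apply: eq_integral => z _; rewrite -!EFinM; congr EFin.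
have := pdf_shift (z + mu * t); rewrite addrK => ->; rewrite /g.
have E1 : expR (- (mu * (z + mu * t))) * expR (mu * (z + mu * t)) = 1.
  by rewrite -expRD addNr expR0.
transitivity (f (z + mu * t) * bm * nhat (z + mu * t)
  * (expR (- (mu * (z + mu * t))) * expR (mu * (z + mu * t)))); first by rewrite E1; ring.
by ring.
Qed.

Let f_supp (z1 z2 z : R) : z1 < z2 ->
  bump ((z - (z1 + z2) / 2) / ((z2 - z1) / 2)) = 0 \/ z1 <= z <= z2.
Proof.
move=> z12; set v := (z2 - z1) / 2.
have v0 : 0 < v by rewrite divr_gt0// subr_gt0.
have [h|h] := ltP 1 `|(z - (z1 + z2) / 2) / v|.
  by left; have [] := bump_out h.
right; move: h; rewrite normrM [X in _ * X]gtr0_norm ?invr_gt0//.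
by rewrite ler_pdivrMr// mul1r /v ler_norml => /andP[h1 h2]; apply/andP; split; lra.
Qed.

(** On the support [z1, z2] of the bump both [nhat] and z |-> [K (cosh z)] are nonincreasing.
    Replacing each by an end value in the equal integrals of [K_bump] and dividing by the mass of
    the bump compares them at opposite ends. *)
Let K_sandwich (z1 z2 : R) : 0 < z1 -> z1 < z2 ->
  (K (cosh z2) <= (bm * nhat z1)%:E)%E /\ ((bm * nhat z2)%:E <= K (cosh z1))%E.
Proof.
move=> z10 z12; have := K_bump z10 z12.
set m := (z1 + z2) / 2; set v := (z2 - z1) / 2 => /=.
have v0 : 0 < v by rewrite divr_gt0// subr_gt0.
have /andP[I0 Iy] := @integral_bump_bounds R m v v0.
set I := (\int[_]_u _)%E in I0 Iy.
have Ifin : I \is a fin_num by rewrite ge0_fin_numE// ltW.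
have mf : measurable_fun setT (fun z : R => (bump ((z - m) / v))%:E).
  apply/measurable_EFinP; apply: measurableT_comp.
    by apply: continuous_measurable_fun; exact: continuous_bump.
  by apply: measurable_funM => //; exact: measurable_funB.
have f0 z : (0 <= (bump ((z - m) / v))%:E :> \bar R)%E by rewrite lee_fin bump_ge0.
have bm0 : 0 <= bm by rewrite ltW// bump_mass_gt0.
have n0 z : 0 <= nhat z by rewrite mulr_ge0 ?expR_ge0.
have mn : measurable_fun setT (fun z : R => (bm * nhat z)%:E).
  by apply/measurable_EFinP; apply: measurable_funM => //; exact: measurable_funM.
have mK : measurable_fun setT (fun z : R => K (cosh z)).
  have := @measurable_kern_coshx R d T P B hB mu t t_gt0 0.
  by apply: eq_measurable_fun => z _; rewrite /coshx mul0r addr0.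
have K0 C : (0 <= K C)%E by exact: kern_ge0.
have le_cst (h1 h2 : R -> \bar R) : measurable_fun setT h1 -> measurable_fun setT h2 ->
    (forall z, 0 <= h1 z)%E -> (forall z, (z1 <= z <= z2)%R -> h1 z <= h2 z)%E ->
    (\int[leb]_z ((bump ((z - m) / v))%:E * h1 z)
     <= \int[leb]_z ((bump ((z - m) / v))%:E * h2 z))%E.
  move=> mh1 mh2 h10 h12; apply: ge0_le_integral => //.
  - by move=> z _; rewrite mule_ge0.
  - by apply: emeasurable_funM; [exact: mf|exact: mh1].
  - by apply: emeasurable_funM; [exact: mf|exact: mh2].
  - move=> z _; have [->|h] := f_supp z z12; first by rewrite !mul0e.
    by rewrite lee_wpmul2l// h12.
have Icst (k : \bar R) : (0 <= k)%E ->
    (\int[leb]_z ((bump ((z - m) / v))%:E * k) = I * k)%E.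
  by move=> k0; rewrite ge0_integralZr.
have n0E z : (0 <= (bm * nhat z)%:E :> \bar R)%E by rewrite lee_fin mulr_ge0.
have mc (k : \bar R) : measurable_fun setT (fun _ : R => k) by exact: measurable_cst.
move=> E; split.
- have H : (I * K (cosh z2) <= I * (bm * nhat z1)%:E)%E.
    rewrite -!Icst//; apply: (@le_trans _ _ (\int[leb]_z ((bump ((z - m) / v))%:E * K (cosh z)))%E).
      apply: (le_cst (fun=> K (cosh z2)) (fun z => K (cosh z)) (mc _) mK (fun=> K0 _)).
      move=> z /andP[h1 h2]; apply: K_antitone.
      by apply: cosh_homo h2; exact: lt_le_trans h1.
    rewrite -E.
    apply: (le_cst (fun z => (bm * nhat z)%:E) (fun=> (bm * nhat z1)%:E) mn (mc _) n0E).
    by move=> z /andP[h1 h2]; rewrite lee_fin; apply: ler_wpM2l => //; exact: nhat_antitone.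
  by move: H; rewrite lee_pmul2l.
- have H : (I * (bm * nhat z2)%:E <= I * K (cosh z1))%E.
    rewrite -!Icst//; apply: (@le_trans _ _ (\int[leb]_z ((bump ((z - m) / v))%:E * K (cosh z)))%E).
      rewrite -E.
      apply: (le_cst (fun=> (bm * nhat z2)%:E) (fun z => (bm * nhat z)%:E) (mc _) mn (fun=> n0E _)).
      move=> z /andP[h1 h2]; rewrite lee_fin; apply: ler_wpM2l => //.
      by apply: nhat_antitone h2; exact: lt_le_trans h1.
    apply: (le_cst (fun z => K (cosh z)) (fun=> K (cosh z1)) mK (mc _) (fun=> K0 _)).
    by move=> z /andP[h1 h2]; apply: K_antitone; exact: cosh_homo.
  by move: H; rewrite lee_pmul2l.
Qed.

Lemma kern_cosh (z : R) : 0 < z -> K (cosh z) = (bm * nhat z)%:E.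
Proof.
move=> z0.
have ch : @harmonic R n @[n --> \oo] --> 0 by exact: cvg_harmonic.
have cb (s : R) : (bm * nhat (z + s * harmonic n))%:E @[n --> \oo] --> (bm * nhat z)%:E.
  apply: cvg_EFin; first exact: nearW.
  apply: cvgM; first exact: cvg_cst.
  apply: (@cvg_comp _ _ _ (fun n => z + s * harmonic n) nhat _ (nbhs z));
    last exact: continuous_nhat.
  have {2}-> : z = z + s * 0 by rewrite mulr0 addr0.
  by apply: cvgD; [exact: cvg_cst|apply: cvgM => //; exact: cvg_cst].
have h0 n : 0 < @harmonic R n by rewrite /harmonic/= invr_gt0.
have h1 n : @harmonic R n.+1 < 1 by rewrite /harmonic/= invf_lt1// ltr1n.
apply/eqP; rewrite eq_le; apply/andP; split.
(* The approximation z (1 - [harmonic n.+1]) from below must stay positive; the index starts at n.+1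
   because [harmonic 0] is 1. *)
- have cs : (bm * nhat (z + (- z) * harmonic n.+1))%:E @[n --> \oo] --> (bm * nhat z)%:E.
    by have := cb (- z); rewrite -(@cvg_shiftS _ (fun n => (bm * nhat (z + - z * harmonic n))%:E)).
  apply: (lee_cvg_to (cvg_cst _) cs); apply: nearW => n.
  apply: (K_sandwich _ _).1.
  + have := h1 n; have := h0 n.+1; nra.
  + have := h0 n.+1; nra.
- apply: (lee_cvg_to (cb 1) (cvg_cst _)); apply: nearW => n.
  by apply: (K_sandwich z0 _).2; rewrite mul1r ltrDl.
Qed.

(** [phi x z] is arcosh of c = [coshx x z]: the expression under the root is c^2 - 1, and c +
    sqrt(c^2 - 1) has inverse c - sqrt(c^2 - 1). For x > 0, c exceeds 1 even at z = 0, whence the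
    strict positivity. *)
Lemma cosh_phi (x z : R) : 0 < x -> 0 < phi x z /\ cosh (phi x z) = coshx x z.
Proof.
move=> x0; set c := coshx x z.
have e0 : 0 < expR (- z) := expR_gt0 _.
have ez : expR z * expR (- z) = 1 by rewrite -expRD subrr expR0.
have c1 : 1 < c.
  have h : 1 <= cosh z.
    by rewrite /cosh; have := expR_gt0 z; have := sqr_ge0 (expR z - expR (- z)); nra.
  by rewrite /c /coshx; have := mulr_gt0 x0 e0; lra.
have sE : x ^+ 2 * expR (- (2 * z)) + sinh z ^+ 2 + 2 * x * expR (- z) * cosh z
    = c ^+ 2 - 1.
  have -> : expR (- (2 * z)) = expR (- z) ^+ 2.
    by rewrite expr2 -expRD; congr expR; ring.
  transitivity (c ^+ 2 - expR z * expR (- z)); last by rewrite ez.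
  by rewrite /c /coshx /cosh /sinh; field.
have s0 : 0 < c ^+ 2 - 1 by rewrite subr_gt0 exprn_egt1.
set q := Num.sqrt (c ^+ 2 - 1).
have q0 : 0 < q by rewrite sqrtr_gt0.
have q2 : q ^+ 2 = c ^+ 2 - 1 by rewrite sqr_sqrtr// ltW.
have pE : phi x z = ln (c + q).
  by rewrite /phi sE; congr (ln (_ + _)); rewrite /c /coshx addrC.
have cq0 : 0 < c + q by lra.
rewrite pE; split; first by rewrite ln_gt0//; lra.
rewrite /cosh expRN lnK//.
have -> : (c + q)^-1 = c - q.
  apply: (mulfI (lt0r_neq0 cq0)); rewrite divff ?gt_eqF//.
  have -> : (c + q) * (c - q) = c ^+ 2 - q ^+ 2 by ring.
  by rewrite q2; ring.
by field.
Qed.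

Let mphi x : measurable_fun setT (@phi R x).
Proof.
have me c : measurable_fun setT (fun y : R => expR (c * y)).
  by apply: measurableT_comp => //; exact: measurable_funM.
have mN : measurable_fun setT (fun y : R => expR (- y)).
  by apply: measurableT_comp => //; exact: measurable_funN.
have mc : measurable_fun setT (@cosh R).
  by apply: measurable_funM => //; exact: measurable_funD.
have ms : measurable_fun setT (@sinh R).
  by apply: measurable_funM => //; exact: measurable_funB.
apply: (measurableT_comp (@measurable_ln R)).
apply: measurable_funD.
  by apply: measurable_funD => //; exact: measurable_funM.
apply: (@measurableT_comp _ _ _ _ _ _ (@Num.sqrt R)).
  by apply: continuous_measurable_fun; exact: sqrt_continuous.
apply: measurable_funD; first apply: measurable_funD.
- apply: measurable_funM => //; apply: measurableT_comp => //.
  by apply: measurable_funN; exact: measurable_funM.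
- exact: measurable_funX.
- by apply: measurable_funM => //; exact: measurable_funM.
Qed.

(** With f = 1, the relation r e^(-Y) = 1 / A makes the left-hand side of [kernel_identity] the
    Laplace transform. As x > 0 makes [phi x z] positive, [kern_cosh] evaluates the kernel at every
    z. *)
Lemma laplace_inverse_functional (x : R) : 0 < x ->
  (\int[P]_w (expR (- (x / A w)))%:E = G P B mu t x)%E.
Proof.
move=> x0.
have hc (y : R) : is_derive y 1 (fun=> 1 : R) (0 : R) by exact: is_derive_cst.
have c0 : continuous (fun _ : R => 0 : R) by move=> y; exact: cvg_cst.
have := @kernel_identity R d T P B hB mu t t_gt0 x (fun=> 1) (fun=> 0) (ltW x0)
  (fun=> ler01) hc c0.
rewrite -/K.
have bm0 : 0 < bm := bump_mass_gt0 R.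
have A0 w : 0 < A w := expBM_functional_gt0 hB mu t_gt0 w.
have mE : measurable_fun setT (fun w => (expR (- (x / A w)))%:E).
  have mi : measurable_fun setT (fun w => expR (- (x * expR (- ln (A w))))).
    apply: measurableT_comp => //; apply: measurable_funN.
    apply: measurable_funM => //; apply: measurableT_comp => //.
    exact: measurable_funN.
  move/measurable_EFinP : mi; apply: eq_measurable_fun => w _ /=.
  by rewrite [expR (- ln _)]expRN lnK// posrE.
have -> : (\int[P]_w (expR (- (x * (ratio (B t w + mu * t) (expBM_functional B mu t w)
      * expR (- (B t w + mu * t))))) * 1 * bump_mass R)%:E
    = bm%:E * \int[P]_w (expR (- (x / A w)))%:E)%E.
  rewrite -ge0_integralZl//; last by rewrite lee_fin ltW.
  apply: eq_integral => w _; rewrite -EFinM mulr1 mulrC; congr ((_ * expR (- (x * _)))%:E).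
  by rewrite /ratio -expRD addrAC subrr add0r expRN lnK// posrE.
pose h z : R := expR (mu * z) * nhat (phi x z).
have mh : measurable_fun setT h.
  apply: measurable_funM; first by apply: measurableT_comp => //; exact: measurable_funM.
  apply: measurable_funM => //; exact: (measurableT_comp mpdf (mphi x)).
have h0 z : 0 <= h z by rewrite mulr_ge0 ?expR_ge0// mulr_ge0 ?expR_ge0.
have -> : (\int[leb]_z ((1 * expR (mu * z))%:E * K (coshx x z))
    = bm%:E * \int[leb]_z (h z)%:E)%E.
  rewrite -ge0_integralZl//; last 3 first.
  - exact/measurable_EFinP.
  - by move=> z _; rewrite lee_fin.
  - by rewrite lee_fin ltW.
  apply: eq_integral => z _; have [p0 <-] := cosh_phi z x0.
  by rewrite kern_cosh// -!EFinM mul1r /h mulrCA.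
move=> /(congr1 (mule (bm^-1)%:E)).
rewrite !muleA -EFinM mulVf ?gt_eqF// !mul1e => ->; rewrite /G.
rewrite (@ge0_integral_BM (fun b => (expR (mu * b + (b ^+ 2 - phi x b ^+ 2) / (2 * t)))%:E));
  last 2 first.
- apply/measurable_EFinP; apply: measurableT_comp => //; apply: measurable_funD.
    exact: measurable_funM.
  apply: measurable_funM => //; apply: measurable_funB; first exact: measurable_funX.
  by apply: measurable_funX; exact: mphi.
- by move=> b; rewrite lee_fin expR_ge0.
rewrite -ge0_integralZl//; last 2 first.
- apply: emeasurable_funM; apply/measurable_EFinP; last exact: mpdf.
  apply: measurableT_comp => //; apply: measurable_funD.
    exact: measurable_funM.
  apply: measurable_funM => //; apply: measurable_funB; first exact: measurable_funX.
  by apply: measurable_funX; exact: mphi.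
- by move=> z _; rewrite -EFinM lee_fin mulr_ge0 ?expR_ge0.
apply: eq_integral => z _; rewrite -!EFinM; congr EFin.
rewrite /h /nhat !pdfE.
set E := expR (- (t * mu ^+ 2) / 2); set N := normal_peak _.
(* Multiplying and dividing by exp(z^2 / (2 t)) restores the density of B_t; hence the term B_t^2 in
   [G]. *)
transitivity (E * N * (expR (mu * z) * expR (- phi x z ^+ 2 / (2 * t)))); first by ring.
transitivity (E * N * (expR (mu * z + (z ^+ 2 - phi x z ^+ 2) / (2 * t))
  * expR (- z ^+ 2 / (2 * t)))); last by ring.
rewrite -!expRD; congr (_ * expR _).
by field; rewrite gt_eqF.
Qed.

End laplace.

(** * Tonelli's theorem on measurable subsets *)

Section tonelli_on_sets.
Context (d1 d2 : measure_display) (T1 : measurableType d1) (T2 : measurableType d2).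
Context (R : realType).
Variables (m1 : {sigma_finite_measure set T1 -> \bar R}).
Variables (m2 : {sigma_finite_measure set T2 -> \bar R}).
Variables (D1 : set T1) (D2 : set T2) (f : T1 -> T2 -> R).
Hypotheses (mD1 : measurable D1) (mD2 : measurable D2).
Hypothesis mf : measurable_fun setT (fun p : T1 * T2 => f p.1 p.2).
Hypothesis f0 : forall x y, 0 <= f x y.

Lemma measurable_integral_in :
  measurable_fun setT (fun x => (\int[m2]_(y in D2) (f x y)%:E)%E).
Proof.
pose h (p : T1 * T2) := (f p.1 p.2 * \1_D2 p.2)%:E.
have h0 p : (0 <= h p)%E by rewrite lee_fin mulr_ge0// indicE.
have mh : measurable_fun setT h.
  apply/measurable_EFinP; apply: measurable_funM => //.
  exact: (measurableT_comp (measurable_indic mD2)).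
have := measurable_fun_fubini_tonelli_F (m2 := m2) h mh h0.
apply: eq_measurable_fun => x _; rewrite /fubini_F [RHS]integral_mkcond epatch_indic.
by apply: eq_integral => y _; rewrite /h/= -EFinM.
Qed.

Lemma fubini_tonelli_in :
  (\int[m1]_(x in D1) \int[m2]_(y in D2) (f x y)%:E
   = \int[m2]_(y in D2) \int[m1]_(x in D1) (f x y)%:E)%E.
Proof.
pose h (p : T1 * T2) := (f p.1 p.2 * \1_D1 p.1 * \1_D2 p.2)%:E.
have h0 p : (0 <= h p)%E by rewrite lee_fin mulr_ge0 ?indicE// mulr_ge0.
have mh : measurable_fun setT h.
  apply/measurable_EFinP; apply: measurable_funM.
    by apply: measurable_funM => //; exact: (measurableT_comp (measurable_indic mD1)).
  exact: (measurableT_comp (measurable_indic mD2)).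
transitivity (\int[m1]_x \int[m2]_y h (x, y))%E.
  rewrite integral_mkcond; apply: eq_integral => x _; rewrite patchE.
  case: ifPn => xD.
    rewrite integral_mkcond epatch_indic; apply: eq_integral => y _.
    by rewrite /h/= (indicE R D1) xD mulr1 -EFinM.
  rewrite integral0_eq// => y _.
  by rewrite /h/= (indicE R D1) (negbTE xD) mulr0 mul0r.
rewrite fubini_tonelli//; apply/esym.
rewrite integral_mkcond; apply: eq_integral => y _; rewrite patchE.
case: ifPn => yD.
  rewrite integral_mkcond epatch_indic; apply: eq_integral => x _.
  by rewrite /h/= (indicE R D2) yD mulr1 -EFinM.
rewrite integral0_eq// => x _.
by rewrite /h/= (indicE R D2) (negbTE yD) mulr0.
Qed.

End tonelli_on_sets.

(** * Integrals over the half-line *)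

Section frullani.
Context (R : realType).
Notation leb := (@lebesgue_measure R).

(** The endpoint 0 is negligible: default values there, as of a division by 0, do not affect the
    integral. *)
Lemma eq_integral_pos (f g : R -> \bar R) : measurable_fun setT g ->
  (forall y, 0 < y -> f y = g y) ->
  (\int[leb]_(y in `[0%R, +oo[) f y = \int[leb]_(y in `[0%R, +oo[) g y)%E.
Proof.
move=> mg fg.
have mg' : measurable_fun (`]0%R, +oo[%classic : set R) g by exact: measurable_funTS.
have fgD (y : R) : y \in (`]0%R, +oo[%classic : set R) -> g y = f y.
  by move/set_mem => /=; rewrite in_itv/= andbT => y0; rewrite fg.
have mf : measurable_fun (`]0%R, +oo[%classic : set R) f by exact: eq_measurable_fun mg'.
rewrite -(integral_itv_obnd_cbnd mf) -(integral_itv_obnd_cbnd mg').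
by apply: eq_integral => y yD; rewrite fgD.
Qed.

Lemma integral_expRN (l : R) : 0 < l ->
  (\int[leb]_(y in `[0%R, +oo[) (expR (- (l * y)))%:E = (l^-1)%:E)%E.
Proof.
move=> l0.
have me : measurable_fun (`[0%R, +oo[%classic : set R) (fun y : R => (expR (- (l * y)))%:E).
  apply/measurable_EFinP; apply: measurable_funTS; apply: measurableT_comp => //.
  by apply: measurable_funN; exact: measurable_funM.
have H : (l%:E * \int[leb]_(y in `[0%R, +oo[) (expR (- (l * y)))%:E = 1)%E.
  rewrite -ge0_integralZl//; last by rewrite lee_fin ltW.
  rewrite -(integral_exponential_pdf l0) integral_mkcond.
  apply: eq_integral => y _; rewrite /exponential_pdf !patchE; case: ifP => // _.
  by rewrite -EFinM mulNr.
have : ((l^-1)%:E * (l%:E * \int[leb]_(y in `[0%R, +oo[) (expR (- (l * y)))%:E)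
    = (l^-1)%:E)%E by rewrite H mule1.
by rewrite muleA -EFinM mulVf ?gt_eqF// mul1e.
Qed.

Lemma integral_segment_derive (F f : R -> R) (a b : R) : a < b ->
  (forall x : R, a <= x <= b -> is_derive x 1 F (f x)) ->
  (forall x : R, a <= x <= b -> {for x, continuous f}) ->
  (\int[leb]_(x in `[a, b]) (f x)%:E = (F b - F a)%:E)%E.
Proof.
move=> ab hF cf.
have cF x : a <= x <= b -> {for x, continuous F}.
  by move=> /hF hx; apply/differentiable_continuous/derivable1_diffP; have [] := hx.
rewrite (@continuous_FTC2 _ f F)//.
- apply: continuous_in_subspaceT => x /set_mem /=; rewrite in_itv/=; exact: cf.
- split.
  + move=> x; rewrite in_itv/= => /andP[/ltW h1 /ltW h2].
    by have [] := hF x; rewrite ?h1 ?h2.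
  + by apply: cvg_at_right_filter; apply: cF; rewrite lexx ltW.
  + by apply: cvg_at_left_filter; apply: cF; rewrite lexx ltW.
- move=> x; rewrite in_itv/= => /andP[/ltW h1 /ltW h2].
  have hx : is_derive x 1 F (f x) by apply: hF; rewrite h1 h2.
  by rewrite derive1E derive_val.
Qed.

Lemma integral_expRN_segment (y b : R) : 0 < y -> 0 < b ->
  (\int[leb]_(s in `[0%R, b]) (expR (- (y * s)))%:E
   = ((1 - expR (- (y * b))) / y)%:E)%E.
Proof.
move=> y0 b0.
have hd (s : R) : is_derive s 1 (fun s => - (y * s)) (- y).
  by apply: is_derive_eq; rewrite /GRing.scale/= mulr1.
have he (s : R) := is_derive_expR_comp (hd s).
have hF (s : R) : 0 <= s <= b ->
    is_derive s 1 (fun s => - (expR (- (y * s)) / y)) (expR (- (y * s))).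
  move=> _; have h := he s.
  by apply: is_derive_eq; rewrite /GRing.scale/=; field; rewrite gt_eqF.
have hc (s : R) : 0 <= s <= b -> {for s, continuous (fun s => expR (- (y * s)))}.
  by move=> _; apply/differentiable_continuous/derivable1_diffP; have [] := he s.
rewrite (integral_segment_derive b0 hF hc) mulr0 oppr0 expR0.
by congr EFin; ring.
Qed.

Lemma integral_inv_segment (c b : R) : 0 < c -> 0 < b ->
  (\int[leb]_(s in `[0%R, b]) ((s + c)^-1)%:E = (ln (b + c) - ln c)%:E)%E.
Proof.
move=> c0 b0.
have hF (s : R) : 0 <= s <= b -> is_derive s 1 (fun s => ln (s + c)) (s + c)^-1.
  move=> /andP[s0 _].
  have hs : is_derive s 1 (fun s : R => s + c) 1.
    by apply: is_derive_eq; rewrite addr0.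
  have cs : 0 < s + c by lra.
  have := @is_derive1_comp _ (@ln R) (fun s => s + c) s _ _ (is_derive1_ln cs) hs.
  by rewrite mulr1.
have hc (s : R) : 0 <= s <= b -> {for s, continuous (fun s => (s + c)^-1)}.
  move=> /andP[s0 _]; apply: cvgV; first by rewrite gt_eqF//; lra.
  by apply: cvgD; [exact: cvg_id|exact: cvg_cst].
by rewrite (integral_segment_derive b0 hF hc) add0r.
Qed.

(** (1 - e^(-y b)) / y is the integral of e^(-y s) over s in [0, b]. By Tonelli the integral in y
    comes first and gives 1 / (s + c). *)
Lemma frullani_integral (c b : R) : 0 < c -> 0 < b ->
  (\int[leb]_(y in `[0%R, +oo[)
     (expR (- (c * y)) * ((1 - expR (- (y * b))) / y))%:E
   = (ln (b + c) - ln c)%:E)%E.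
Proof.
move=> c0 b0.
pose k (y s : R) : R := expR (- (c * y)) * expR (- (y * s)).
have k0 y s : 0 <= k y s by rewrite mulr_ge0 ?expR_ge0.
have mk : measurable_fun setT
    (fun p : measurableTypeR R * measurableTypeR R => k p.1 p.2).
  apply: measurable_funM; apply: measurableT_comp => //; apply: measurable_funN;
    exact: measurable_funM.
have me (y : R) : measurable_fun (`[0%R, b]%classic : set R)
    (fun s => (expR (- (y * s)))%:E).
  apply/measurable_EFinP; apply: measurable_funTS; apply: measurableT_comp => //.
  by apply: measurable_funN; exact: measurable_funM.
rewrite (@eq_integral_pos _ (fun y => \int[leb]_(s in `[0%R, b]) (k y s)%:E)%E);
  last 2 first.
- exact: (@measurable_integral_in _ _ (measurableTypeR R) (measurableTypeR R) R leb
    `[0%R, b]%classic k (measurable_itv _) mk k0).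
- move=> y y0; rewrite EFinM -integral_expRN_segment//.
  rewrite -ge0_integralZl//; last exact: me.
rewrite (@fubini_tonelli_in _ _ (measurableTypeR R) (measurableTypeR R) R leb leb
  `[0%R, +oo[%classic `[0%R, b]%classic k (measurable_itv _) (measurable_itv _) mk k0).
rewrite -integral_inv_segment//.
apply: eq_integral => s /set_mem /=; rewrite in_itv/= => /andP[s0 _].
rewrite -integral_expRN ?ltr_wpDl//; apply: eq_integral => y _.
by rewrite /k -expRD; congr (expR _)%:E; ring.
Qed.

End frullani.

(** * The two expectations *)

Section main.
Context (R : realType) (d : measure_display) (T : measurableType d).
Variables (P : probability T R) (B : R -> T -> R).
Hypothesis hB : is_standard_BM P B.
Variables (mu beta t : R).
Hypotheses (beta_gt0 : 0 < beta) (t_gt0 : 0 < t).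
Notation leb := (@lebesgue_measure R).

Let A := expBM_functional B mu t.
Let A_gt0 w : 0 < A w := expBM_functional_gt0 hB mu t_gt0 w.

Let mA : measurable_fun setT A := measurable_expBM hB mu t_gt0.

(** The inverse of A, written so that its measurability and positivity are immediate. *)
Let iA w := expR (- ln (A w)).

Let iAE w : iA w = (A w)^-1.
Proof. by rewrite /iA expRN lnK// posrE. Qed.

Let miA : measurable_fun setT iA.
Proof.
apply: measurableT_comp => //; apply: measurable_funN.
exact: (measurableT_comp (@measurable_ln R) mA).
Qed.

Let iA_gt0 w : 0 < iA w := expR_gt0 _.

(** Replaces [G] by the Laplace transform of 1 / A, valid for y > 0, and exchanges the integrals.
    The weight [q'] of the theorem may misbehave at 0 or change sign for y < 0; [q] is a version to
    which Tonelli applies. *)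
Lemma integral_G_weight (q' q : R -> R) : measurable_fun setT q ->
  (forall y, 0 <= q y) -> (forall y, 0 < y -> q' y = q y) ->
  (\int[leb]_(y in `[0%R, +oo[) (G P B mu t y * (q' y)%:E)
   = \int[P]_w \int[leb]_(y in `[0%R, +oo[) (expR (- (iA w * y)) * q y)%:E)%E.
Proof.
move=> mq q0 qE.
pose k (y : R) w : R := expR (- (iA w * y)) * q y.
have k0 y w : 0 <= k y w by rewrite mulr_ge0 ?expR_ge0.
have m1 : measurable_fun setT (fun p : measurableTypeR R * T => p.1).
  exact: measurable_fst.
have m2 : measurable_fun setT (fun p : measurableTypeR R * T => iA p.2).
  exact: (measurableT_comp miA measurable_snd).
have mk : measurable_fun setT (fun p : measurableTypeR R * T => k p.1 p.2).
  apply: measurable_funM; last exact: (measurableT_comp mq m1).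
  apply: (measurableT_comp (@measurable_expR R)); apply: measurable_funN.
  exact: (measurable_funM m2 m1).
have mE (y : R) : measurable_fun setT (fun w => (expR (- (y / A w)))%:E).
  apply/measurable_EFinP; apply: (measurableT_comp (@measurable_expR R)).
  apply: measurable_funN.
  apply: (@eq_measurable_fun _ _ _ _ _ (fun w => y * iA w)).
    by move=> w _; rewrite iAE.
  exact: (measurable_funM (@measurable_cst _ _ _ _ _ y) miA).
have qE0 (y : R) : (0 <= (q y)%:E :> \bar R)%E by rewrite lee_fin.
have E0 (y : R) w : setT w -> (0 <= (expR (- (y / A w)))%:E :> \bar R)%E.
  by rewrite lee_fin expR_ge0.
rewrite (@eq_integral_pos _ _ (fun y => \int[P]_w (k y w)%:E)%E); last 2 first.
- exact: (@measurable_integral_in _ _ (measurableTypeR R) T R P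
    setT k measurableT mk k0).
- move=> y y0; rewrite qE// -(laplace_inverse_functional hB mu t_gt0 y0).
  rewrite -(ge0_integralZr P measurableT (mE y) (E0 y) (qE0 y)).
  by apply: eq_integral => w _; rewrite -EFinM /k iAE [_^-1 * _]mulrC.
exact: (@fubini_tonelli_in _ _ (measurableTypeR R) T R leb P
  `[0%R, +oo[%classic setT k (measurable_itv _) measurableT mk k0).
Qed.

Lemma expectation_inv :
  (\int[P]_w ((1 + beta * A w)^-1)%:E
   = 1 - beta%:E * \int[leb]_(y in `[0%R, +oo[)
          (G P B mu t y * (expR (- (y * beta)))%:E))%E.
Proof.
have mq : measurable_fun setT (fun y : R => expR (- (y * beta))).
  by apply: measurableT_comp => //; apply: measurable_funN; exact: measurable_funM.
rewrite (integral_G_weight mq (fun _ => expR_ge0 _) (fun _ _ => erefl)).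
(* The integral of e^(-y / A) e^(-y beta) is 1 / (1 / A + beta), and [u] = beta A / (1 + beta A) = 1
   - 1 / (1 + beta A). *)
pose u w := beta * (iA w + beta)^-1.
have u01 w : 0 <= u w <= 1.
  have h : 0 < iA w + beta by rewrite addr_gt0.
  rewrite /u mulr_ge0 ?invr_ge0 ?(ltW h) ?(ltW beta_gt0)//=.
  by rewrite ler_pdivrMr// mul1r lerDr ltW.
have mi : measurable_fun setT (fun w => (iA w + beta)^-1).
  have := measurable_funD miA (@measurable_cst _ _ _ _ setT beta).
  move/(measurableT_comp (@measurable_ln R))/measurable_funN.
  move/(measurableT_comp (@measurable_expR R)).
  apply: eq_measurable_fun => w _ /=.
  by rewrite expRN lnK// posrE addr_gt0.
have mu' : measurable_fun setT u by exact: measurable_funM.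
have -> : (beta%:E * \int[P]_w \int[leb]_(y in `[0%R, +oo[)
    (expR (- (iA w * y)) * expR (- (y * beta)))%:E = \int[P]_w (u w)%:E)%E.
  transitivity (beta%:E * \int[P]_w ((iA w + beta)^-1)%:E)%E.
    congr (_ * _)%E; apply: eq_integral => w _; rewrite -integral_expRN ?addr_gt0//.
    apply: eq_integral => y _; rewrite -expRD.
    by rewrite mulrDl opprD [beta * y]mulrC.
  have mi' : measurable_fun setT (fun w => ((iA w + beta)^-1)%:E) by exact/measurable_EFinP.
  have i0 w : setT w -> (0 <= ((iA w + beta)^-1)%:E :> \bar R)%E.
    by rewrite lee_fin invr_ge0 ltW// addr_gt0.
  have b0 : (0 <= beta%:E :> \bar R)%E by rewrite lee_fin ltW.
  by rewrite -(ge0_integralZl P measurableT mi' i0 b0).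
have -> : (1 = \int[P]_w (1 : R)%:E :> \bar R)%E.
  have := integral_cst P measurableT (1%:E : \bar R).
  by rewrite mul1e => h; exact: (esym (etrans h (probability_setT P))).
rewrite -integralB_EFin//; last 2 first.
- by apply: (@bounded_integrable R d T P (cst 1) 1) => // w; rewrite normr1.
- apply: (@bounded_integrable R d T P u 1) => // w.
  by have /andP[h1 h2] := u01 w; rewrite ger0_norm.
apply: eq_integral => w _; rewrite -EFinB; congr EFin.
have a0 := A_gt0 w; rewrite /u iAE; field.
by rewrite !gt_eqF//= ?addr_gt0 ?mulr_gt0.
Qed.

Lemma expectation_ln :
  (\int[P]_w (ln (1 + beta * A w))%:E
   = \int[leb]_(y in `[0%R, +oo[)
       (G P B mu t y * ((1 - expR (- (y * beta))) / y)%:E))%E.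
Proof.
(* Unlike (1 - exp(-y beta)) / y, its value on ]0, +oo[, this is visibly
   nonnegative and measurable on the whole line. *)
pose q (y : R) := `|1 - expR (- (y * beta))| * expR (- ln y).
have q0 y : 0 <= q y by rewrite mulr_ge0 ?expR_ge0.
have qE y : 0 < y -> (1 - expR (- (y * beta))) / y = q y.
  move=> y0; rewrite /q [expR (- ln _)]expRN lnK ?posrE// ger0_norm// subr_ge0.
  by rewrite -[leRHS]expR0 ler_expR oppr_le0 mulr_ge0 ?ltW.
have mq : measurable_fun setT q.
  apply: measurable_funM; apply: measurableT_comp => //; last exact: measurable_funN.
  apply: measurable_funB => //; apply: measurableT_comp => //.
  by apply: measurable_funN; exact: measurable_funM.
have mc (c : R) : measurable_fun setT (fun y : R => (expR (- (c * y)) * q y)%:E).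
  apply/measurable_EFinP; apply: measurable_funM => //; apply: measurableT_comp => //.
  by apply: measurable_funN; exact: measurable_funM.
rewrite (integral_G_weight mq q0 qE); apply: eq_integral => w _.
rewrite -(@eq_integral_pos _ (fun y : R =>
  (expR (- (iA w * y)) * ((1 - expR (- (y * beta))) / y))%:E)); last 2 first.
- exact: mc.
- by move=> y y0; rewrite qE.
rewrite frullani_integral// iAE; congr EFin.
have a0 := A_gt0 w.
(* With c = 1 / A, ln (beta + 1 / A) - ln (1 / A) = ln ((beta + 1 / A) A). *)
rewrite lnV ?posrE// opprK -lnM ?posrE ?addr_gt0 ?invr_gt0//.
by congr ln; field; rewrite gt_eqF.
Qed.

End main.

Theorem theorem2p8 (R : realType) (d : measure_display) (T : measurableType d)
    (P : probability T R) (B : R -> T -> R) (mu beta t : R) :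
  is_standard_BM P B -> 0 < beta -> 0 < t ->
  (\int[P]_w (ln (1 + beta * expBM_functional B mu t w))%:E
     = \int[lebesgue_measure]_(y in `[0%R, +oo[)
          (G P B mu t y * ((1 - expR (- (y * beta))) / y)%:E))%E /\
  (\int[P]_w ((1 + beta * expBM_functional B mu t w)^-1)%:E
     = 1 - beta%:E * \int[lebesgue_measure]_(y in `[0%R, +oo[)
          (G P B mu t y * (expR (- (y * beta)))%:E))%E.
Proof.
move=> hB beta0 t0; split.
  exact: expectation_ln.
exact: expectation_inv.
Qed.
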